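(* If $G$ is a $30$-connected graph, then $G$ is $4$-linked. Consequently, $g(4)\le 30$.
   Context: Graphs are finite and simple. A graph is $m$-connected if it has more than $m$ vertices and deleting any set of fewer than $m$ vertices leaves a connected graph. For an integer $k\ge 2$, a graph $G$ is $k$-linked if it has at least $2k$ vertices and for every $2k$ distinct vertices $u_1,v_1,u_2,v_2,\ldots,u_k,v_k$ of $G$ there are $k$ pairwise vertex-disjoint paths $P_1,\ldots,P_k$ in $G$ such that $P_i$ connects $u_i$ and $v_i$ for each $i$. For $k\ge 2$, $g(k)$ denotes the least integer such that every $g(k)$-connected graph is $k$-linked. *)

(* Defs.v *)
From mathcomp Require Import all_boot.

Set Implicit Arguments.
Unset Strict Implicit.
Unset Printing Implicit Defensive.

Record sgraph := SGraph {
  vertex :> finType;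
  adj : rel vertex;
  adj_sym : symmetric adj;
  adj_irrefl : irreflexive adj }.

Section DeleteVertices.
Variables (G : sgraph) (S : {set G}).

Definition del_adj : rel {x : G | x \notin S} := relpre val (@adj G).

Lemma del_adj_sym : symmetric del_adj.
Proof. by move=> x y; apply: adj_sym. Qed.

Lemma del_adj_irrefl : irreflexive del_adj.
Proof. by move=> x; apply: adj_irrefl. Qed.

Definition del_vertices : sgraph := SGraph del_adj_sym del_adj_irrefl.

End DeleteVertices.

(* The empty graph counts as connected here; [m_connected] never tests it,
   since it deletes fewer than m vertices from a graph with more than m. *)
Definition connected_graph (G : sgraph) : Prop :=
  forall x y : G, connect (@adj G) x y.

Definition m_connected (m : nat) (G : sgraph) : Prop :=
  m < #|G| /\
  forall S : {set G}, #|S| < m -> connected_graph (del_vertices S).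

(* In mathcomp's exploded representation of paths, the vertex sequence is
   [x :: p]; [uniq] makes it a path in the graph-theoretic sense. *)
Definition is_path (G : sgraph) (x y : G) (p : seq G) : Prop :=
  [/\ path (@adj G) x p, last x p = y & uniq (x :: p)].

Definition k_linked (k : nat) (G : sgraph) : Prop :=
  2 * k <= #|G| /\
  forall u v : k.-tuple G, uniq (u ++ v) ->
  exists p : 'I_k -> seq G,
    (forall i : 'I_k, is_path (tnth u i) (tnth v i) (p i)) /\
    (forall i j : 'I_k, i != j ->
       [disjoint (tnth u i :: p i) & (tnth u j :: p j)]).

Definition connectivity_forces_linked (k n : nat) : Prop :=
  forall G : sgraph, m_connected n G -> k_linked k G.

(* [is_g k n] reads "g(k) = n", for k >= 2.  Minimising over nat rather than
   over all integers loses nothing: for m <= 0 every nonempty graph is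
   m-connected, and a single vertex is not k-linked. *)
Definition is_g (k n : nat) : Prop :=
  connectivity_forces_linked k n /\
  forall m : nat, connectivity_forces_linked k m -> n <= m.

(* Main.v *)
Require Import Defs.
From Stdlib Require Import Classical.
From mathcomp Require Import all_boot zify.

(* Call a graph with interior W and at most eight terminals X massed if more than
   15|W| edges meet W, while every part of W cut off by fewer than |X| vertices meets
   at most 15 edges per vertex (Thomas and Wollan).  A 30-connected graph is massed
   for any eight terminals, and a massed graph is linked: in a minimal counterexample
   no part of W behind at most |X| vertices is linked, hence every edge meeting W
   lies in at least 15 triangles (else contract it) and some v in W has degree at
   most 29 (else delete an edge).  So N(v) induces a graph with at most 29 vertices
   and minimum degree 15, up to a few exceptional terminals.  By Menger's theorem X
   is joined by disjoint paths to N(v), and it remains to link four pairs inside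
   N(v) + v.  The vertex v takes care of one pair; take shortest paths for two others.
   If the two remaining pairs are both separated by these paths, then a counting
   argument shows that the smaller side, with parts of the paths, is so close to
   complete that it contains a 4-linked graph, to which X can be joined instead. *)

Set Implicit Arguments.
Unset Strict Implicit.
Unset Printing Implicit Defensive.

(** * Menger's theorem *)

(** Density takes the place of connectivity because it survives contraction: the contracted vertex
    carries a weight of 15 edges, so losing at most 15 edges with it is harmless. The exceptional
    terminals come from the edges inside X, which are not counted: contracting v into a terminal h
    also loses every edge from v to a further terminal. Once all edges between differently labelled
    terminals are present, the only such loss that is not already part of a triangle is due to the
    partner of h. Partners are exceptional together, so the number of exceptions is never one.
    Moreover v is chosen so that its degree plus its number of neighbours in X is at most 30, and
    this pays for each exception with one vertex of N(v). The bounds 29 and 15 leave a slack of one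
    in the final count: a vertex of the smaller side has no non-neighbour or just one there, up to
    the exceptions, and a pair that is not adjacent can then be joined through a free vertex. *)

Section Walks.
Variable V : finType.
Implicit Types (r : rel V) (S T X Q A U : {set V}).

Definition restr r U : rel V := fun a b => [&& r a b, a \in U & b \in U].
Definition stop r S : rel V := fun a b => r a b && (a \notin S).
Definition mono (L : eqType) r (c : V -> L) : rel V :=
  fun a b => r a b && (c a == c b).

Lemma first_hit r S x y : connect r x y ->
  connect (stop r S) x y \/ exists2 a, a \in S & connect (stop r S) x a.
Proof.
case/connectP=> p; elim: p x => [|z p IH] x /= => [_ -> | /andP[xz zp] ey].
  by left; apply: connect0.
have [xS|xS] := boolP (x \in S); first by right; exists x => //; apply: connect0.
have step : connect (stop r S) x z by apply: connect1; rewrite /stop xz xS.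
case: (IH _ zp ey) => [h|[a aS h]]; first by left; apply: connect_trans h.
by right; exists a => //; apply: connect_trans h.
Qed.

Lemma connect_inv r r' (P : pred V) x y :
  P x -> (forall a b, P a -> r a b -> r' a b && P b) ->
  connect r x y -> connect r' x y && P y.
Proof.
move=> Px step /connectP[p]; elim: p x Px => [|z p IH] x Px /=.
  by move=> _ ->; rewrite connect0.
case/andP=> xz zp ey; have /andP[xz' Pz] := step _ _ Px xz.
have /andP[h ->] := IH _ Pz zp ey.
by rewrite (connect_trans (connect1 xz') h).
Qed.

Lemma connect_keep r (P : pred V) x y :
  P x -> (forall a b, P a -> r a b -> P b) -> connect r x y -> P y.
Proof.
move=> Px step h.
by have /andP[] := connect_inv (r' := r) Px (fun a b Pa ab => introT andP (conj ab (step a b Pa ab))) h.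
Qed.

Lemma connect_sym_of r : symmetric r -> connect_sym r.
Proof. by move=> rs; apply: sym_connect_sym. Qed.

Lemma restr_sym r U : symmetric r -> symmetric (restr r U).
Proof. by move=> rs a b; rewrite /restr rs; congr (_ && _); rewrite andbC. Qed.

Lemma mono_sym (L : eqType) r (c : V -> L) : symmetric r -> symmetric (mono r c).
Proof. by move=> rs a b; rewrite /mono rs eq_sym. Qed.

Lemma connect_restr_in r U x y : x \in U -> connect (restr r U) x y -> y \in U.
Proof.
move=> xU; apply: (connect_keep (P := mem U)) => // a b _ /and3P[_ _]; exact.
Qed.

Lemma ex_subset_card A k : k <= #|A| -> exists2 B : {set V}, B \subset A & #|B| = k.
Proof.
move=> kA; exists [set x in take k (enum A)].
  by apply/subsetP=> x; rewrite inE => /mem_take; rewrite mem_enum.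
rewrite cardsE (card_uniqP _) ?size_take -?cardE ?take_uniq ?enum_uniq //.
by move: kA; rewrite leq_eqVlt => /orP[/eqP->|->//]; rewrite ltnn.
Qed.

Definition sep r X Q S : Prop := forall x q,
  x \in X -> q \in Q -> x \notin S -> q \notin S ->
  ~~ connect (restr r (~: S)) x q.

(** Disjoint paths encoded by a colouring: each starting point x names its own colour class and
    reaches Q inside it, and distinct classes are disjoint. *)
Definition flow r X Q k : Prop :=
  exists (c : V -> V) (X0 : {set V}), [/\ X0 \subset X, #|X0| = k &
    forall x, x \in X0 -> c x = x /\ exists2 q, q \in Q & connect (mono r c) x q].

Definition reach r X S : {set V} :=
  [set a | [exists x in X :\: S, connect (restr r (~: S)) x a]].

Lemma reach_notin r X S a : a \in reach r X S -> a \notin S.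
Proof.
rewrite inE => /existsP[x /andP[]]; rewrite inE => /andP[xS _] h.
by have := connect_restr_in _ h; rewrite !inE; apply.
Qed.

Lemma reach_step r X S a b : a \in reach r X S -> r a b -> b \notin S ->
  b \in reach r X S.
Proof.
move=> aR ab bS; have aS := reach_notin aR; move: aR.
rewrite !inE => /existsP[x /andP[xX h]]; apply/existsP; exists x.
by rewrite xX (connect_trans h) //; apply: connect1; rewrite /restr ab !inE aS.
Qed.

Lemma reach0 r X S a : a \in X -> a \notin S -> a \in reach r X S.
Proof. by move=> aX aS; rewrite inE; apply/existsP; exists a; rewrite inE aS aX connect0. Qed.

Lemma sep_sym r X Q S : symmetric r -> sep r X Q S -> sep r Q X S.
Proof.
move=> rs h x q xQ qX xS qS; rewrite connect_sym_of ?h //; exact: restr_sym.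
Qed.

Lemma reach_disj r X Q S a : symmetric r -> sep r X Q S ->
  a \in reach r X S -> a \in reach r Q S -> False.
Proof.
move=> rs h; rewrite !inE => /existsP[x /andP[]]; rewrite inE => /andP[xS xX] xa.
case/existsP=> q /andP[]; rewrite inE => /andP[qS qQ] qa.
have /negP := h _ _ xX qQ xS qS; apply; apply: connect_trans xa _.
by rewrite connect_sym_of //; apply: restr_sym.
Qed.

Definition del r x y : rel V :=
  fun a b => r a b && ~~ (((a == x) && (b == y)) || ((a == y) && (b == x))).

Lemma del_sym r x y : symmetric r -> symmetric (del r x y).
Proof. by move=> rs a b; rewrite /del rs; congr (_ && ~~ _); rewrite orbC andbC [(a == x) && _]andbC. Qed.

Lemma del_swap r x y a b : del r x y a b = del r y x a b.
Proof. by rewrite /del orbC. Qed.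

(* If a set separates X from Q once the edge xy is removed, a set separating
   X from S + x in the smaller graph already separates X from Q. *)
Lemma sep_extend r X Q S x y S' : symmetric r ->
  sep (del r x y) X Q S -> x \in reach (del r x y) X S -> y \in reach (del r x y) Q S ->
  sep (del r x y) X (x |: S) S' -> sep r X Q S'.
Proof.
set r' := del r x y => rs sepS xA yB sepS' x0 q x0X qQ x0S' qS'; apply/negP=> h.
have r's : symmetric r' by apply: del_sym.
set T := x |: S.
pose P a := (a \in reach r' X S) || (a \in T).
have P0 : P x0.
  rewrite /P; have [//|x0S] := boolP (x0 \in S); first by rewrite /T !inE => ->; rewrite !orbT.
  by rewrite reach0.
have inv a b : P a -> stop (restr r (~: S')) T a b -> restr r' (~: S') a b && P b.
  move=> Pa /andP[/and3P[ab aS' bS'] aT]; move: Pa; rewrite /P (negPf aT) orbF => aA.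
  have ax : a != x by apply: contraNneq aT => ->; rewrite !inE eqxx.
  have ay : a != y by apply: contraTneq aA => ->; apply/negP=> yA; apply: (reach_disj r's sepS yA yB).
  have ab' : r' a b by rewrite /r' /del ab (negPf ax) (negPf ay).
  rewrite /restr ab' aS' bS' /=.
  have [bS|bS] := boolP (b \in S); first by rewrite /T !inE bS !orbT.
  by rewrite (reach_step aA ab').
have key t : t \in T -> connect (stop (restr r (~: S')) T) x0 t -> False.
  move=> tT /(connect_inv P0 inv)/andP[ct _].
  have tS' : t \notin S' by have := connect_restr_in _ ct; rewrite !inE; apply.
  by have := sepS' _ _ x0X tT x0S' tS'; rewrite ct.
case: (first_hit T h) => [h1|[t tT]]; last exact: key.
have [qT|qT] := boolP (q \in T); first exact: key h1.
have /andP[_] := connect_inv P0 inv h1; rewrite /P (negPf qT) orbF => qA.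
apply: (reach_disj r's sepS qA); apply: reach0 => //.
by move: qT; rewrite !inE negb_or => /andP[].
Qed.

Lemma flow_del r X Q k x y : flow (del r x y) X Q k -> flow r X Q k.
Proof.
case=> c [X0 [h1 h2 h3]]; exists c, X0; split=> // z /h3[cz [q qQ zq]].
split=> //; exists q => //; apply: connect_sub zq => a b /andP[/andP[ab _] cc].
by apply: connect1; rewrite /mono ab.
Qed.

(** The first flow, cut where it meets S + x, stays on the side of X; the second, cut where it meets
    S + y, stays on the side of Q. They are joined in the vertices of S and along the edge xy. On
    the side of Q the colours of the second flow are renamed after the first. *)
Lemma flow_glue r X Q S x y : symmetric r -> r x y ->
  sep (del r x y) X Q S -> x \in reach (del r x y) X S -> y \in reach (del r x y) Q S ->
  flow (del r x y) X (x |: S) #|S|.+1 -> flow (del r x y) (y |: S) Q #|S|.+1 ->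
  flow r X Q #|S|.+1.
Proof.
set r' := del r x y => rs rxy sepS xA yB [c1 [X0 [X0X kX0 h1]]] [c2 [Y0 [Y0Y kY0 h2]]].
have r's : symmetric r' by apply: del_sym.
have yS := reach_notin yB.
have eY : Y0 = y |: S by apply/eqP; rewrite eqEcard Y0Y kY0 cardsU1 yS add1n leqnn.
pose A := reach r' X S; pose B := reach r' Q S.
have AB a : a \in A -> a \in B -> False by apply: reach_disj.
pose c v := if (v \in A) || (v \in S) then c1 v
            else if c2 v == y then c1 x else c1 (c2 v).
have r'r a b : r' a b -> r a b by case/andP.
exists c, X0; split=> // x0 x0X0; have [c1x0 [t0 t0T x0t0]] := h1 _ x0X0.
have x0X := subsetP X0X _ x0X0.
have AS0 : (x0 \in A) || (x0 \in S).
  by have [|xS] := boolP (x0 \in S); rewrite ?orbT // /A reach0.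
split; first by rewrite /c AS0.
(* Up to its first vertex in [x |: S] the walk cannot leave the side of X, where [c] and [c1]
   agree. *)
have [t tT x0t] : exists2 t, t \in x |: S & connect (stop (mono r' c1) (x |: S)) x0 t.
  by case: (first_hit (x |: S) x0t0) => [h|//]; exists t0.
pose P v := ((v \in A) || (v \in S)) && (c1 v == x0).
have /andP[x0t' /andP[_ /eqP c1t]] : connect (mono r c) x0 t && P t.
  apply: connect_inv x0t; first by rewrite /P AS0 c1x0 /=.
  move=> a b /andP[aAS c1a] /andP[/andP[ab cab] aT].
  have aA : a \in A by case/orP: aAS aT => // aS; rewrite !inE aS orbT.
  have bAS : (b \in A) || (b \in S).
    by have [|bS] := boolP (b \in S); rewrite ?orbT // /A (reach_step aA ab).
  by rewrite /P bAS -(eqP cab) c1a /mono /c aAS bAS cab r'r.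
have [s [sY xs]] : exists s, s \in y |: S /\ ((s == t) && (t \in S) || (s == y) && (t == x)).
  case/setU1P: tT => [->|tS]; first by exists y; rewrite !inE !eqxx orbT.
  by exists t; rewrite !inE tS orbT eqxx.
have [c2s [q qQ sq]] := h2 s ltac:(by rewrite eY).
exists q => //.
have cs : c s = c1 t.
  rewrite /c; case/orP: xs => /andP[/eqP es]; first by move=> tS; rewrite es tS orbT.
  move/eqP=> ->; rewrite es in c2s *; rewrite (negPf yS) orbF.
  by case: ifP => [/AB/(_ yB)//|_]; rewrite c2s eqxx.
apply: connect_trans x0t' _.
apply: (@connect_trans _ _ s).
  case/orP: xs => /andP[/eqP es]; first by rewrite es connect0.
  move/eqP=> et; apply: connect1; rewrite /mono cs et es rxy /=.
  by rewrite /c /A xA.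
rewrite connect_sym_of; last exact: mono_sym.
have qs : connect (mono r' c2) q s by rewrite connect_sym_of //; apply: mono_sym.
have c2q : c2 q = s.
  apply/eqP; apply: (connect_keep (P := fun v => c2 v == s)) sq; first by apply/eqP.
  by move=> a b /eqP ca /andP[_ /eqP <-]; rewrite ca eqxx.
(* Read backwards from Q, the path of [s] first meets [y |: S] in [s] itself, since every vertex of
   [y |: S] starts a path of its own colour. *)
have [t2 t2T qt2] : exists2 t2, t2 \in y |: S & connect (stop (mono r' c2) (y |: S)) q t2.
  by case: (first_hit (y |: S) qs) => [h|//]; exists s.
pose P2 v := ((v \in B) || (v \in S)) && (c2 v == s).
have BS0 : (q \in B) || (q \in S).
  by have [|xS] := boolP (q \in S); rewrite ?orbT // /B reach0.
have t2s : t2 = s.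
  have /andP[_ /eqP] : P2 t2.
    apply: connect_keep qt2; first by rewrite /P2 BS0 c2q eqxx.
    move=> a b /andP[aBS /eqP c2a] /andP[/andP[ab cab] aT] /=.
    have aB : a \in B by case/orP: aBS aT => // aS; rewrite !inE aS orbT.
    rewrite /P2 -(eqP cab) c2a eqxx andbT.
    by have [|bS] := boolP (b \in S); rewrite ?orbT // /B (reach_step aB ab).
  by have := h2 t2; rewrite eY => /(_ t2T)[-> _].
rewrite t2s in qt2.
have cB v : v \in B -> c2 v = s -> c v = c1 t.
  move=> vB c2v; rewrite /c (negPf (reach_notin vB)) orbF.
  case: ifP => [/AB/(_ vB)//|_]; rewrite c2v.
  case/orP: xs => /andP[/eqP es tS].
    by case: eqP => [ey|_]; [case/negP: yS; rewrite -ey es | rewrite es].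
  by rewrite es eqxx (eqP tS).
have P2c v : P2 v -> c v = c1 t.
  case/andP=> /orP[vB /eqP|vS /eqP c2v]; first exact: cB.
  have [c2v' _] := h2 v ltac:(by rewrite eY !inE vS orbT).
  by rewrite -c2v' c2v cs.
have /andP[//] : connect (mono r c) q s && P2 s.
apply: connect_inv qt2; first by rewrite /P2 BS0 c2q eqxx.
move=> a b Pa /andP[/andP[ab cab] aT].
have Pb : P2 b.
  case/andP: (Pa) => aBS /eqP c2a.
  have aB : a \in B by case/orP: aBS aT => // aS; rewrite !inE aS orbT.
  rewrite /P2 -(eqP cab) c2a eqxx andbT.
  by have [|bS] := boolP (b \in S); rewrite ?orbT // /B (reach_step aB ab).
by rewrite Pb andbT /mono (P2c a) // (P2c b) // eqxx r'r.
Qed.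

(** A walk from X to Q that avoids S has to use the deleted edge, so this edge leads out of the part
    reached from X. *)
Lemma reach_open r X Q S x y : symmetric r -> 
  sep (del r x y) X Q S -> ~ sep r X Q S ->
  exists a b, [/\ a \in reach (del r x y) X S, b \notin reach (del r x y) X S
    & ((a == x) && (b == y)) || ((a == y) && (b == x))].
Proof.
move=> rs sepS nsep; apply: NNPP => no; apply: nsep => x0 q x0X qQ x0S qS.
apply/negP=> h; set A := reach (del r x y) X S.
have qA : q \in A.
  apply: (connect_keep (P := mem A)) h; first exact: reach0.
  move=> a b aA /and3P[ab _]; rewrite inE => bS /=.
  have [bA//|bA] := boolP (b \in A).
  case E : (((a == x) && (b == y)) || ((a == y) && (b == x))).
    by case: no; exists a, b; rewrite E.
  by case/negP: bA; apply: reach_step aA _ bS; rewrite /del ab E.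
apply: (reach_disj (del_sym _ _ rs) sepS qA); exact: reach0.
Qed.

(** Induction on the edges. If deleting xy leaves a separator S with fewer than k vertices, then xy
    joins its two sides, and a set that separates X from S + x, or S + y from Q, in the smaller
    graph separates X from Q in the full one. So the smaller graph has k disjoint paths in both
    places, and |S| = k - 1. *)
Theorem menger r X Q k : symmetric r ->
  (forall S, sep r X Q S -> k <= #|S|) -> flow r X Q k.
Proof.
move En : #|[set p : V * V | r p.1 p.2]| => n.
elim/ltn_ind: n => n IH in r X Q k En *; move=> rs minS.
have [/eqP|] := boolP ([set p : V * V | r p.1 p.2] == set0).
  move=> /setP r0; have kXQ : k <= #|X :&: Q|.
    apply: minS => x q xX qQ xS qS; apply/negP=> h.
    have /eqP e : q == x.
      apply: (connect_keep (P := pred1 x) (y := q)) h; first exact: eqxx.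
      by move=> a b _ /and3P[ab _ _]; have := r0 (a, b); rewrite !inE ab.
    by case/negP: xS; rewrite inE xX -e.
  have [X0 X0s X0k] := ex_subset_card kXQ; exists id, X0; split=> //.
    exact: subset_trans X0s (subsetIl _ _).
  move=> x /(subsetP X0s); rewrite inE => /andP[xX xQ]; split=> //.
  by exists x => //; apply: connect0.
case/set0Pn=> -[x y]; rewrite inE /= => rxy.
have lt : #|[set p : V * V | del r x y p.1 p.2]| < n.
  rewrite -En; apply: proper_card; apply/properP; split.
    by apply/subsetP=> p; rewrite !inE => /andP[].
  by exists (x, y); rewrite !inE //= /del !eqxx andbF.
have r's := del_sym x y rs.
have [ok|] := classic (forall S, sep (del r x y) X Q S -> k <= #|S|).
  by apply: flow_del; apply: (IH _ lt).
move=> nok; have [S nS] := not_all_ex_not _ _ nok; have [sepS /negP] := imply_to_and _ _ nS; rewrite -ltnNge => Sk.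
have nsep : ~ sep r X Q S by move/minS; rewrite leqNgt Sk.
(* Stated for any naming of the deleted edge, because either end may be the one on the side of X. *)
have main x' y' : r x' y' -> (forall a b, del r x y a b = del r x' y' a b) ->
    x' \in reach (del r x y) X S -> y' \in reach (del r x y) Q S -> flow r X Q k.
  move=> rxy' eqd.
  have [del' ed] : exists d, d = del r x y by exists (del r x y).
  rewrite -ed in sepS lt r's *.
  have ed' : forall X S, reach del' X S = reach (del r x' y') X S.
    move=> X1 S1; apply/setP=> a; rewrite !inE; apply: eq_existsb => z.
    by congr (_ && _); apply: eq_connect => u v; rewrite /restr ed eqd.
  have es : forall X Q S, sep del' X Q S <-> sep (del r x' y') X Q S.
    move=> X1 Q1 S1; split=> h u v a1 a2 a3 a4; have := h u v a1 a2 a3 a4;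
    by congr (~~ _); apply: eq_connect => u' v'; rewrite /restr ed eqd.
  rewrite !ed' => xA yB.
  have xS := reach_notin xA.
  have r's2 := del_sym x' y' rs.
  have lt2 : #|[set p : V * V | del r x' y' p.1 p.2]| < n.
    by move: lt; congr (_ < _); apply: eq_card => p; rewrite !inE ed eqd.
  have sepS2 : sep (del r x' y') X Q S by apply/es.
  have kS : k = #|S|.+1.
    apply/eqP; rewrite eqn_leq Sk andbT.
    suff : k <= #|x' |: S| by rewrite cardsU1 xS.
    apply: minS; apply: (sep_extend rs sepS2 xA yB) => u v uX vT uS vS.
    by rewrite vT in vS.
  rewrite kS; apply: (flow_glue rs rxy' sepS2 xA yB).
    apply: (IH _ lt2) => // S' /(sep_extend rs sepS2 xA yB)/minS.
    by rewrite kS.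
  apply: (IH _ lt2) => // S' sS'; rewrite -kS; apply: minS.
  apply: sep_sym => //.
  have eqd2 a b : del r x' y' a b = del r y' x' a b by apply: del_swap.
  apply: (@sep_extend r Q X S y' x') => //.
  - move=> u v a1 a2 a3 a4; rewrite -(eq_connect (e := restr (del r x' y') (~: S))).
      by apply: sep_sym sepS2 _ _ _ _ _ _.
    by move=> u' v'; rewrite /restr eqd2.
  - rewrite inE; rewrite inE in yB; move: yB; congr is_true; apply: eq_existsb => z.
    by congr (_ && _); apply: eq_connect => u v; rewrite /restr eqd2.
  - rewrite inE; rewrite inE in xA; move: xA; congr is_true; apply: eq_existsb => z.
    by congr (_ && _); apply: eq_connect => u v; rewrite /restr eqd2.
  - move=> u v a1 a2 a3 a4; rewrite -(eq_connect (e := restr (del r x' y') (~: S'))).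
      by apply: sep_sym sS' _ _ _ _ _ _.
    by move=> u' v'; rewrite /restr eqd2.
have [a [b [aA bA ab]]] := reach_open rs sepS nsep.
have sepS' := sep_sym r's sepS.
have nsep' : ~ sep r Q X S by move=> h; apply: nsep; apply: sep_sym.
have [a' [b' [aB bB ab']]] := reach_open rs sepS' nsep'.
have dis z : z \in reach (del r x y) X S -> z \in reach (del r x y) Q S -> False.
  exact: reach_disj.
case/orP: ab => /andP[/eqP ea /eqP eb]; case/orP: ab' => /andP[/eqP ea' /eqP eb']; subst.
- by case: (dis _ aA aB).
- by apply: (main x y).
- by apply: (main y x) => //; [rewrite rs|move=> u v; apply: del_swap].
- by case: (dis _ aA aB).
Qed.

End Walks.

Lemma exists_minimum (T : Type) (P : T -> Prop) (f : T -> nat) :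
  (exists x, P x) -> exists x, P x /\ forall y, P y -> f x <= f y.
Proof.
case=> x; move En : (f x) => n; elim/ltn_ind: n x En => n IH x En Px.
case: (classic (exists2 y, P y & f y < n)) => [[y Py yn]|no]; first exact: (IH _ yn y).
exists x; split=> // y Py; rewrite En leqNgt; apply/negP=> h; apply: no; by exists y.
Qed.

(** * Linkages and hubs *)

Section Linked.
Variable V : finType.
Implicit Types (e r : rel V) (S T X Q A U W D : {set V}) (l c : V -> nat).

(** Refines [stop]: S is entered in y only. Each single step then shows whether its target lies in
    S, which the invariants below need because they recolour S. *)
Definition stop_at r S y : rel V := fun a b => [&& r a b, a \notin S & (b \notin S) || (b == y)].

Lemma hit_or_avoid r S x y : connect r x y ->
  connect (restr r (~: S)) x y \/ exists2 a, a \in S & connect (stop_at r S a) x a.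
Proof.
case/connectP=> p; elim: p x => [|z p IH] x /= => [_ -> | /andP[xz zp] ey].
  by left; apply: connect0.
have [xS|xS] := boolP (x \in S); first by right; exists x => //; apply: connect0.
have [zS|zS] := boolP (z \in S).
  by right; exists z => //; apply: connect1; rewrite /stop_at xz xS eqxx orbT.
case: (IH _ zp ey) => [h|[a aS h]].
  by left; apply: connect_trans h; apply: connect1; rewrite /restr xz !inE xS zS.
by right; exists a => //; apply: connect_trans h; apply: connect1; rewrite /stop_at xz xS zS.
Qed.

Lemma hit_target r S x y : y \in S -> connect r x y ->
  exists2 a, a \in S & connect (stop_at r S a) x a.
Proof.
move=> yS /(hit_or_avoid S)[h|//]; exists x; last exact: connect0.
by apply: contraTT yS => xS; have := connect_restr_in _ h; rewrite !inE; apply.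
Qed.

Lemma stop_at_start r S x y : x \in S -> connect (stop_at r S y) x y -> y = x.
Proof.
move=> xS h; apply/eqP; apply: (connect_keep (P := pred1 x)) h => /=; first exact: eqxx.
by move=> a b /eqP-> /and3P[_]; rewrite xS.
Qed.

Lemma connect_subrel r r' x y : subrel r r' -> connect r x y -> connect r' x y.
Proof. by move=> h; apply: connect_sub => a b /h; apply: connect1. Qed.

Definition color_rel e (L : eqType) (c : V -> L) U : rel V :=
  fun a b => [&& e a b, c a == c b, a \in U & b \in U].

Lemma color_rel_sym e (L : eqType) (c : V -> L) U : symmetric e -> symmetric (color_rel e c U).
Proof. by move=> es a b; rewrite /color_rel es eq_sym; do 2!congr (_ && _); rewrite andbC. Qed.

Definition atmost2 X l := forall i, #|[set x in X | l x == i]| <= 2.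

(* A linkage is encoded by a colouring of the vertices: the labels l say which
   terminals of X are to be joined, and the paths run inside colour classes, so
   they are disjoint and avoid the other vertices of X. *)
Definition linked e U X := forall l, atmost2 X l ->
  exists2 c, {in X, c =1 l} &
    forall x y, x \in X -> y \in X -> l x = l y -> connect (color_rel e c U) x y.

(* Any eight vertices of Q can be linked inside D and Q, however they are paired. *)
Definition hub e D Q := forall S, S \subset Q -> #|S| <= 8 -> linked e (D :|: Q) S.

(** Outside X every vertex receives a label of its own, beyond those on X, so that a labelling of X
    extends to any larger set without new demands. *)
Lemma fresh_label X l : atmost2 X l ->
  exists2 l', {in X, l' =1 l} & atmost2 setT l'.
Proof.
move=> h; pose N := (\max_(z in X) l z).+1.
have ltN z : z \in X -> l z < N by move=> zX; rewrite ltnS leq_bigmax_cond.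
exists (fun z => if z \in X then l z else N + enum_rank z) => [z ->//|i].
have [iN|iN] := ltnP i N.
  apply: leq_trans (h i); apply: subset_leq_card; apply/subsetP=> z; rewrite !inE /=.
  by case: ifP => // _ /eqP ei; move: iN; rewrite -ei ltnNge leq_addr.
have key z : (if z \in X then l z else N + enum_rank z) == i -> i = N + enum_rank z.
  case: ifP => [/ltN|_ /eqP <-] // h1 /eqP ei; by move: h1 iN; lia.
apply: (@leq_trans 1) => //; apply/card_le1_eqP=> z z'; rewrite !inE.
move=> /key ez /key ez'; apply: enum_rank_inj; apply: val_inj; apply/eqP.
by rewrite -(eqn_add2l N) -ez ez'.
Qed.

Lemma atmost2_sub X X' l : X \subset X' -> atmost2 X' l -> atmost2 X l.
Proof.
move=> /subsetP sX h i; apply: leq_trans (h i); apply: subset_leq_card.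
by apply/subsetP=> z; rewrite !inE => /andP[/sX-> ->].
Qed.

Lemma linked_sub e U S S' : S \subset S' -> linked e U S' -> linked e U S.
Proof.
move=> sS h l /fresh_label[l' l'l l'2].
have [c cl' lc] := h l' (atmost2_sub (subsetT _) l'2).
have sS' := subsetP sS.
exists c => [x xS|x y xS yS e1]; first by rewrite cl' ?sS' ?l'l.
by apply: lc; rewrite ?sS' // !l'l.
Qed.

Lemma linked1 e U X : #|X| <= 1 -> linked e U X.
Proof.
move=> X1 l _; exists l => // x y xX yX _.
by move/card_le1_eqP: X1 => /(_ _ _ xX yX)->; apply: connect0.
Qed.

(* Deleting W and making S a clique: the paths through W that end in S are
   replaced by single edges. *)
Definition fill e W S : rel V := fun a b =>
  [&& a \notin W, b \notin W, a != b & e a b || (a \in S) && (b \in S)].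

Lemma fill_sym e W S : symmetric e -> symmetric (fill e W S).
Proof.
move=> es a b; rewrite /fill es [_ == b]eq_sym [_ && (b \in S)]andbC.
by rewrite andbCA.
Qed.

(** Follow each path of the filled graph from its terminal to the first vertex in S; up to there no
    clique edge is used. Each colour has at most two such landing vertices, so the linkage of S
    inside W can join them again. Paths that miss S are kept. *)
Lemma linked_fill e W S U X : symmetric e -> [disjoint W & U] ->
  X \subset U -> S \subset U -> linked e (W :|: S) S ->
  linked (fill e W S) U X -> linked e (U :|: W) X.
Proof.
move=> es WU XU SU WS UX l l2; have [c' c'l c'c] := UX l l2.
have WnU z : z \in U -> z \notin W by move=> zU; rewrite (disjointFl WU zU).
pose r' := color_rel (fill e W S) c' U.
have r's : symmetric r' by apply/color_rel_sym/fill_sym.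
pose go x a := (a \in S) && connect (stop_at r' S a) x a.
pose al x := odflt x [pick a | go x a].
have go_c x a : go x a -> c' a = c' x.
  case/andP=> _ h; apply/eqP; apply: (connect_keep (P := fun z => c' z == c' x)) h => //.
  by move=> a1 b /eqP <- /and3P[/and4P[_ /eqP-> _ _] _ _].
have alP x : (exists a, go x a) -> go x (al x).
  by rewrite /al; case: pickP => // no [a]; rewrite no.
pose F := [set al x | x in [set x in X | [exists a, go x a]]].
have F2 : atmost2 F c'.
  move=> i; apply: leq_trans (l2 i).
  apply: leq_trans (leq_imset_card al _); apply: subset_leq_card; apply/subsetP=> z.
  rewrite !inE => /andP[/imsetP[x]]; rewrite inE => /andP[xX /existsP/alP h] -> /eqP ei.
  by apply/imsetP; exists x; rewrite // inE xX -c'l // -(go_c _ _ h) ei eqxx.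
(* Vertices of S where no path lands get fresh labels, so nothing is demanded of them. *)
have [lB lBF lB2] := fresh_label F2.
have [cB cBl cBc] := WS lB (atmost2_sub (subsetT _) lB2).
pose c z := if z \in W then cB z else if z \in S then lB z else c' z.
have SW z : z \in S -> z \notin W by move=> /(subsetP SU); apply: WnU.
have go_self x : x \in S -> go x x by move=> xS; rewrite /go xS connect0.
have al_self x : x \in S -> al x = x.
  by move=> xS; have /andP[_ h] := alP x (ex_intro _ x (go_self _ xS)); rewrite (stop_at_start xS h).
have cal x : x \in X -> (exists a, go x a) -> c (al x) = c' x /\ al x \in S.
  move=> xX h; have g := alP _ h; have /andP[aS _] := g; split=> //.
  rewrite /c (negPf (SW _ aS)) aS lBF ?(go_c _ _ g) //.
  by apply: imset_f; rewrite inE xX; apply/existsP.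
have cX x : x \in X -> c x = c' x.
  move=> xX; have [xS|xS] := boolP (x \in S).
    have [h _] := cal x xX (ex_intro _ x (go_self _ xS)).
    by rewrite -h al_self.
  by rewrite /c (negPf xS) (negPf (WnU _ (subsetP XU _ xX))).
exists c => [x xX|x y xX yX exy]; first by rewrite cX ?c'l.
have cxy := c'c x y xX yX exy.
have ain u : u \in X -> (exists a, go u a) -> connect (color_rel e c (U :|: W)) u (al u).
  move=> uX h; have [ca aS] := cal _ uX h; have /andP[_] := alP _ h.
  pose P z := (z \in U) && (c z == c' z) && (c' z == c' u).
  move=> st; have /andP[//] : connect (color_rel e c (U :|: W)) u (al u) && P (al u).
  apply: connect_inv st; first by rewrite /P (subsetP XU) // cX // !eqxx.
  move=> a b /andP[/andP[aU caa] cax] /and3P[/and4P[/and4P[_ _ _ eab] cab _ bU] aS' bS].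
  have Pb : P b.
    rewrite /P bU -(eqP cab) cax !andbT.
    case/orP: bS => [bS|/eqP->]; last by rewrite ca eq_sym.
    by rewrite /c (negPf bS) (negPf (WnU _ bU)) (eqP cab) eqxx.
  rewrite Pb andbT /color_rel !inE aU bU /=.
  move: Pb => /andP[/andP[_ /eqP->] _]; rewrite (eqP caa) cab andbT.
  by move: eab; rewrite (negPf aS') orbF => ->.
have [/andP[st yS]|nA] := boolP (connect (restr r' (~: S)) x y && (y \notin S)).
  pose P z := (z \in U) && (c z == c' z).
  have /andP[//] : connect (color_rel e c (U :|: W)) x y && P y.
  apply: connect_inv st; first by rewrite /P (subsetP XU) // cX // !eqxx.
  move=> a b /andP[aU caa] /and3P[/and4P[/and4P[_ _ _ eab] cab _ bU] aS' bS].
  rewrite !inE in aS' bS.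
  have Pb : P b by rewrite /P bU /c (negPf bS) (negPf (WnU _ bU)) eqxx.
  rewrite Pb andbT /color_rel !inE aU bU /=.
  move: Pb => /andP[_ /eqP->]; rewrite (eqP caa) cab andbT.
  by move: eab; rewrite (negPf aS') orbF => ->.
have gx : exists a, go x a.
  case: (hit_or_avoid S cxy) => [st|[a aS st]]; last by exists a; rewrite /go aS.
  move: nA; rewrite st negbK /= => yS.
  have [xS|xS] := boolP (x \in S); first by exists x; apply: go_self.
  by move: yS; have := connect_restr_in _ st; rewrite !inE => /(_ xS)/negPf->.
have gy : exists a, go y a.
  have cyx : connect r' y x by rewrite connect_sym_of.
  case: (hit_or_avoid S cyx) => [st|[a aS st]]; last by exists a; rewrite /go aS.
  move: nA; rewrite connect_sym_of ?st ?negbK /=; last exact: restr_sym.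
  by move=> yS; exists y; apply: go_self.
have [_ axS] := cal _ xX gx; have [_ ayS] := cal _ yX gy.
have UWs : symmetric (color_rel e c (U :|: W)) by apply: color_rel_sym.
apply: connect_trans (ain x xX gx) _; rewrite connect_sym_of //.
apply: connect_trans (ain y yX gy) _; rewrite connect_sym_of //.
have lBx z (zX : z \in X) (gz : exists a, go z a) : lB (al z) = l z.
  have [cz zS] := cal _ zX gz; rewrite -c'l // -cz.
  by rewrite /c zS (negPf (SW _ zS)).
have := cBc _ _ axS ayS; rewrite !lBx // => /(_ exy); apply: connect_subrel.
move=> a b /and4P[ab cab aW bW]; rewrite /color_rel ab /=.
have cc z : z \in W :|: S -> c z = cB z.
  by rewrite /c !inE; case: ifP => //= _ zS; rewrite zS cBl.
rewrite !cc // cab /= !inE; move: aW bW; rewrite !inE.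
by case/orP=> [->|/(subsetP SU)->]; case/orP=> [->|/(subsetP SU)->]; rewrite ?orbT.
Qed.

End Linked.

Section Hub.
Variable V : finType.
Variable e : rel V.
Hypothesis es : symmetric e.
Implicit Types (r : rel V) (S T X Q A U W D : {set V}) (l c : V -> nat).

Definition closed_in W S := forall w y, w \in W -> e w y -> y \in W :|: S.

Lemma sep_notin_reach r X Q S q : sep r X Q S -> q \in Q -> q \notin reach r X S.
Proof.
move=> h qQ; apply/negP=> qR; have qS := reach_notin qR; move: qR; rewrite inE.
case/existsP=> x /andP[]; rewrite inE => /andP[xS xX] c.
by have := h _ _ xX qQ xS qS; rewrite c.
Qed.

(** By Menger's theorem and the minimality of S, |S| disjoint paths lead from S to Q without
    returning to the side of X. They carry any labels on S to Q, where the hub links them. The paths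
    avoid D because the hub needs it. *)
Lemma hub_linked_sep U X D Q S : X \subset U :\: D -> Q \subset U :\: D ->
  D \subset U -> closed_in D Q -> hub e D Q -> #|S| <= 8 ->
  let r := restr e (U :\: D) in
  sep r X Q S -> (forall S', sep r X Q S' -> #|S| <= #|S'|) ->
  linked e ((U :\: reach r X S) :|: S) S /\ S \subset U :\: D.
Proof.
move=> XU QU DU DQ hDQ S8 r sepS minS; set A := reach r X S.
have rs : symmetric r by apply: restr_sym.
pose r2 := restr r (~: A).
have r2s : symmetric r2 by apply: restr_sym.
(* A set separating S from Q beyond [A] also separates X from Q: a walk from Q to X, stopped at its
   first vertex of S, does not enter [A]. *)
have fl : flow r2 S Q #|S|.
  apply: menger => // S' sep2; apply: minS => x q xX qQ xS' qS'; apply/negP=> h.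
  have qA := sep_notin_reach sepS qQ.
  have rS's := restr_sym (~: S') rs.
  have hqx : connect (restr r (~: S')) q x by rewrite connect_sym_of.
  have key a : a \in S -> connect (stop (restr r (~: S')) S) q a -> False.
    move=> aS h1; have /andP[] : connect (restr r2 (~: S')) q a && (a \notin A).
      apply: (connect_inv (P := fun a => a \notin A)) h1; first exact: qA.
      move=> u v uA /andP[/and3P[uv uS' vS'] uS].
      have vA : v \notin A.
        apply: contra uA => vA; apply: (reach_step vA) => //; by rewrite rs.
      by rewrite vA andbT {1}/restr uS' vS' /r2 /restr -/(r u v) uv !in_setC uA vA.
    move=> h2 _; have aS' : a \notin S'.
      by have := connect_restr_in _ h2; rewrite !inE; apply.
    have /negP := sep2 _ _ aS qQ aS' qS'; apply.
    by rewrite connect_sym_of //; apply: restr_sym.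
  case: (first_hit S hqx) => [h1|[a aS]]; last exact: key.
  have [xS|xS] := boolP (x \in S); first exact: key h1.
  have : x \notin A.
    apply: (connect_keep (P := fun a => a \notin A)) h1; first exact: qA.
    move=> u v uA /andP[/and3P[uv uS' vS'] uS].
    by apply: contra uA => vA; apply: (reach_step vA) => //; rewrite rs.
  by rewrite /A reach0.
case: fl => c [X0 [X0S kX0 hc]].
have eX0 : X0 = S by apply/eqP; rewrite eqEcard X0S kX0 leqnn.
rewrite {X0 X0S kX0}eX0 in hc.
pose go s a := (a \in Q) && connect (stop_at (mono r2 c) Q a) s a.
pose al s := odflt s [pick a | go s a].
have alP s : s \in S -> go s (al s).
  move=> sS; rewrite /al; case: pickP => //= no; have [_ [q qQ sq]] := hc s sS.
  by have [a aQ h] := hit_target qQ sq; have := no a; rewrite /go aQ h.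
have cal s : s \in S -> c (al s) = s.
  move=> sS; have [cs _] := hc s sS; have /andP[_ h] := alP s sS.
  apply/eqP; apply: (connect_keep (P := fun z => c z == s)) h; first by rewrite cs.
  by move=> a b /eqP ca /and3P[/andP[_ /eqP <-] _ _]; rewrite ca.
have SUD : S \subset U :\: D.
  apply/subsetP=> s sS; have [_ [q qQ sq]] := hc s sS.
  have qUD := subsetP QU _ qQ.
  have qs : connect (mono r2 c) q s by rewrite connect_sym_of //; apply: mono_sym.
  apply: (connect_keep (P := fun z => z \in U :\: D)) qs => // a b _.
  by case/andP=> /and3P[/and3P[]].
split=> // l l2.
pose F := al @: S; pose lQ z := l (c z).
have FQ : F \subset Q by apply/subsetP=> z /imsetP[s /alP/andP[aQ _] ->].
have F8 : #|F| <= 8 by apply: leq_trans (leq_imset_card _ _) S8.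
have F2 : atmost2 F lQ.
  move=> i; apply: leq_trans (l2 i).
  apply: leq_trans (leq_imset_card al _); apply: subset_leq_card; apply/subsetP=> z.
  rewrite inE => /andP[/imsetP[s sS ->]]; rewrite /lQ cal // => li.
  by apply: imset_f; rewrite inE sS.
have [cQ cQl cQc] := hDQ F FQ F8 lQ F2.
pose cf z := if z \in D :|: Q then cQ z else l (c z).
have alF s : s \in S -> al s \in F by move=> sS; apply: imset_f.
have cfal s : s \in S -> cf (al s) = l s.
  move=> sS; rewrite /cf inE (subsetP FQ) ?alF // orbT cQl ?alF //.
  by rewrite /lQ cal.
have cfS s : s \in S -> cf s = l s.
  move=> sS; have [sQ|sQ] := boolP (s \in Q).
    have /andP[_ h] := alP s sS; rewrite -{1}(stop_at_start sQ h); exact: cfal.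
  have := subsetP SUD _ sS; rewrite inE => /andP[sD _].
  by rewrite /cf inE (negPf sD) (negPf sQ); have [-> _] := hc s sS.
exists cf => // x y xS yS lxy.
have DU' z : z \in U :\: A -> z \in (U :\: A) :|: S by rewrite !inE => ->.
have go_al s : s \in S -> connect (color_rel e cf ((U :\: A) :|: S)) s (al s).
  move=> sS; have /andP[aQ h] := alP s sS; have [cs _] := hc s sS.
  pose P z := [&& c z == s, cf z == l s & z \in (U :\: A) :|: S].
  have /andP[//] : connect (color_rel e cf (U :\: A :|: S)) s (al s) && P (al s).
  apply: connect_inv h; first by rewrite /P cs cfS // !eqxx !inE sS orbT.
  move=> a b /and3P[/eqP ca cfa aW] /and3P[/andP[/and3P[ab _ bA] cab] aQ' bQ].
  case/and3P: ab => ab aUD bUD.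
  have Pb : P b.
    rewrite /P -(eqP cab) ca eqxx /=; apply/andP; split; last first.
      by move: bA bUD; rewrite !inE => -> /andP[_ ->].
    case/orP: bQ => [bQ|/eqP->]; last by rewrite cfal.
    move: bUD; rewrite inE => /andP[bD _].
    by rewrite /cf inE (negPf bD) (negPf bQ) -(eqP cab) ca.
  rewrite Pb andbT /color_rel ab aW /=; case/and3P: Pb => _ /eqP-> ->.
  by rewrite (eqP cfa) eqxx.
have lfs : symmetric (color_rel e cf (U :\: A :|: S)) by apply: color_rel_sym.
apply: connect_trans (go_al x xS) _; rewrite connect_sym_of //.
apply: connect_trans (go_al y yS) _; rewrite connect_sym_of //.
have := cQc _ _ (alF x xS) (alF y yS); rewrite /lQ !cal // => /(_ lxy).
have DQW z : z \in D :|: Q -> z \in (U :\: A) :|: S.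
  move=> zDQ; apply: DU'; rewrite inE; case/setUP: zDQ => zz; last first.
    by rewrite (sep_notin_reach sepS zz); have := subsetP QU _ zz; rewrite inE => /andP[].
  rewrite (subsetP DU) // andbT; apply/negP=> zA.
  suff : z \in U :\: D by rewrite inE zz.
  move: zA; rewrite inE => /existsP[u /andP[]]; rewrite inE => /andP[_ /(subsetP XU) uX].
  by apply: (connect_keep (P := fun v => v \in U :\: D)) => // a b _ /and3P[/and3P[_ _ ->]].
apply: connect_subrel => a b /and4P[ab cab aW bW]; rewrite /color_rel ab !DQW //= andbT.
by rewrite /cf aW bW.
Qed.

Lemma sep_self r X Q : sep r X Q X.
Proof. by move=> x q ->. Qed.

Lemma reach_self r X : reach r X X = set0.
Proof.
by apply/setP=> a; rewrite !inE; apply/existsP=> -[x]; rewrite inE; case: (x \in X).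
Qed.

(** A minimum separator S of X from Q decides. If it is as large as X, then X is itself one and is
    linked through the hub. If it is smaller, the part beyond S is linked to S; this part is not
    empty because Q has more vertices than S. *)
Lemma hub_linked W X D Q : [disjoint W & X] -> closed_in W X -> #|X| <= 8 ->
  D \subset W -> Q \subset (W :|: X) :\: D -> closed_in D Q -> #|X| <= #|Q| ->
  hub e D Q ->
  linked e (W :|: X) X \/
  exists W2 S2, [/\ W2 != set0, W2 \subset W, S2 \subset (W :|: X) :\: W2, #|S2| < #|X| &
    closed_in W2 S2 /\ linked e (W2 :|: S2) S2].
Proof.
move=> WX cW X8 DW QU cD XQ hDQ; set U := W :|: X.
have DU : D \subset U by apply: subset_trans DW (subsetUl _ _).
have XU : X \subset U :\: D.
  apply/subsetP=> x xX; rewrite !inE xX orbT andbT.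
  by apply/negP=> /(subsetP DW) xW; move: xX; rewrite (disjointFr WX xW).
pose r := restr e (U :\: D).
have [S [sepS minS]] : exists S, sep r X Q S /\ forall S', sep r X Q S' -> #|S| <= #|S'|.
  by apply: (exists_minimum (P := sep r X Q)); exists X; apply: sep_self.
have [XS|SX] := leqP #|X| #|S|.
  left; have minX S' : sep r X Q S' -> #|X| <= #|S'| by move/minS; apply: leq_trans.
  have [] := hub_linked_sep XU QU DU cD hDQ X8 (@sep_self _ _ _) minX.
  by rewrite reach_self setD0 -setUA setUid.
right; have S8 : #|S| <= 8 by apply: leq_trans (ltnW SX) X8.
have [lS SU] := hub_linked_sep XU QU DU cD hDQ S8 sepS minS.
set A := reach r X S in lS.
exists ((U :\: A) :\: S), S.
have AU a : a \in A -> a \in U :\: D.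
  rewrite inE => /existsP[u /andP[]]; rewrite inE => /andP[_ /(subsetP XU) uX].
  by apply: (connect_keep (P := fun v => v \in U :\: D)) => // b c _ /and3P[/and3P[_ _ ->]].
have XAS x : x \in X -> x \notin S -> x \in A by move=> xX xS; apply: reach0.
have W2W : (U :\: A) :\: S \subset W.
  apply/subsetP=> z; rewrite !in_setD in_setU => /and3P[zS zA /orP[//|zX]].
  by case/negP: zA; apply: XAS.
have eqU : (U :\: A) :\: S :|: S = (U :\: A) :|: S.
  by apply/setP=> z; rewrite !inE; case: (z \in S); rewrite ?orbT ?orbF.
split=> //; last split.
- have [q qQ qS] : exists2 q, q \in Q & q \notin S.
    apply/subsetPn; apply: contraTN SX => /subset_leq_card; rewrite -leqNgt.
    exact: leq_trans.
  apply/set0Pn; exists q; rewrite !in_setD qS (sep_notin_reach sepS qQ) /=.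
  by have := subsetP QU _ qQ; rewrite in_setD => /andP[].
- by apply/subsetP=> z zS; have := subsetP SU _ zS; rewrite !in_setD zS /= => /andP[_ ->].
- move=> w y wW2 wy; rewrite eqU; have wW := subsetP W2W _ wW2.
  move: wW2; rewrite !in_setD => /and3P[wS wA wU].
  rewrite in_setU in_setD; have [yS|yS] := boolP (y \in S); rewrite ?orbT // orbF.
  have yU := cW _ _ wW wy; rewrite yU andbT.
  apply/negP=> yA; have yUD := AU _ yA.
  have [wD|wD] := boolP (w \in D).
    have := cD _ _ wD wy; rewrite inE; move: (yUD); rewrite inE => /andP[/negPf-> _] /= yQ.
    by have := sep_notin_reach sepS yQ; rewrite yA.
  case/negP: wA; apply: (reach_step yA) => //.
  by rewrite /r /restr es wy yUD in_setD wD (subsetP (subsetUl W X) _ wW).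
- by rewrite eqU.
Qed.
End Hub.

(** * Massed graphs and rigid sets *)

Section Massed.
Variable V : finType.
Implicit Types (e r : rel V) (S T X Q A U W D : {set V}) (l c : V -> nat).

Definition arcset e W : {set V * V} :=
  [set p | e p.1 p.2 && ((p.1 \in W) || (p.2 \in W))].
Definition arcs e W := #|arcset e W|.
Definition boundary e W := [set y | (y \notin W) && [exists w in W, e w y]].

(* W is the interior and X the set of terminals; arcs counts every edge twice,
   so 30 stands for 15 edges per vertex. *)
Definition massed e W X :=
  [/\ [disjoint W & X], closed_in e W X, #|X| <= 8, 30 * #|W| < arcs e W &
    forall W', W' \subset W -> #|boundary e W'| < #|X| -> arcs e W' <= 30 * #|W'|].

Lemma arcs0 e : arcs e set0 = 0.
Proof. by apply/eqP; rewrite cards_eq0; apply/eqP/setP=> p; rewrite !inE andbF. Qed.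

Lemma in_boundary e W w y : w \in W -> e w y -> y \notin W -> y \in boundary e W.
Proof. by move=> wW wy yW; rewrite inE yW; apply/existsP; exists w; rewrite wW. Qed.

Lemma closed_boundary e W : closed_in e W (boundary e W).
Proof.
move=> w y wW wy; rewrite in_setU; have [//|yW] := boolP (y \in W).
by rewrite (in_boundary wW wy yW).
Qed.

Lemma boundary_sub e W S : closed_in e W S -> boundary e W \subset S.
Proof.
move=> cW; apply/subsetP=> y; rewrite inE => /andP[yW /existsP[w /andP[wW wy]]].
by have := cW _ _ wW wy; rewrite inE (negPf yW).
Qed.

Lemma massed_neq0 e W X : massed e W X -> W != set0.
Proof. by case=> _ _ _ h _; apply: contraTneq h => ->; rewrite arcs0. Qed.

(** Among the parts with too many edges take one with the smallest boundary: a part of it with a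
    smaller boundary cannot have too many edges. *)
Lemma submassed e W : 30 * #|W| < arcs e W -> #|boundary e W| <= 8 ->
  exists W', [/\ W' \subset W, massed e W' (boundary e W') & #|boundary e W'| <= #|boundary e W|].
Proof.
move=> mW b8; pose P W' := W' \subset W /\ 30 * #|W'| < arcs e W'.
have [W' [[sW mW'] minW]] : exists W', P W' /\ forall W2, P W2 -> #|boundary e W'| <= #|boundary e W2|.
  by apply: (exists_minimum (P := P)); exists W.
have bW : #|boundary e W'| <= #|boundary e W| by apply: minW.
exists W'; split=> //; split=> //.
- rewrite -setI_eq0; apply/eqP/setP=> y; rewrite in_setI [y \in boundary _ _]inE in_set0.
  by case: (y \in W').
- exact: closed_boundary.
- exact: leq_trans bW b8.
- move=> W2 sW2 b2; rewrite leqNgt; apply/negP=> m2.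
  by move: b2; rewrite ltnNge minW //; split=> //; apply: subset_trans sW2 sW.
Qed.

(** The vertex v stays as an isolated vertex, so that all graphs of the induction live on one type;
    it is dropped from the interior instead. *)
Definition contract e u v : rel V := fun a b =>
  [&& a != v, b != v, a != b & [|| e a b, (a == u) && e v b | (b == u) && e a v]].

Lemma contract_sym e u v : symmetric e -> symmetric (contract e u v).
Proof.
move=> es a b; rewrite /contract (es a b) (es v b) (es a v) (eq_sym a b).
by rewrite andbCA; do 3!congr (_ && _); congr (_ || _); rewrite orbC.
Qed.

Lemma contract_irrefl e u v : irreflexive (contract e u v).
Proof. by move=> a; rewrite /contract eqxx !andbF. Qed.

Lemma fill_irrefl e W S : irreflexive (fill e W S).
Proof. by move=> a; rewrite /fill eqxx !andbF. Qed.

(** With v in the colour class of u, every edge of the contracted graph is an edge or a detour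
    through v. *)
Lemma linked_contract e u v U X : symmetric e -> e u v -> u \in U -> v \notin U ->
  X \subset U -> linked (contract e u v) U X -> linked e (v |: U) X.
Proof.
move=> es uv uU vU XU h l l2; have [c cl cc] := h l l2.
pose c' z := if z == v then c u else c z.
have c'E z : z \in U -> c' z = c z.
  by rewrite /c'; case: eqP => // ->; rewrite (negPf vU).
have c'v : c' v = c u by rewrite /c' eqxx.
exists c' => [x xX|x y xX yX lxy]; first by rewrite c'E ?cl // (subsetP XU).
apply: connect_sub (cc x y xX yX lxy) => a b /and4P[ab /eqP cab aU bU].
have l1 z z' : z \in v |: U -> z' \in v |: U -> e z z' -> c' z = c' z' ->
  connect (color_rel e c' (v |: U)) z z'.
  by move=> zU zU' zz' czz'; apply: connect1; rewrite /color_rel zz' czz' eqxx zU zU'.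
have vU' : v \in v |: U by rewrite !inE eqxx.
have UU z : z \in U -> z \in v |: U by rewrite !inE => ->; rewrite orbT.
case/and4P: ab => _ _ _ /or3P[ab|/andP[/eqP ea vb]|/andP[/eqP eb av]].
- by apply: l1; rewrite ?c'E //; apply: UU.
- subst a; apply: (@connect_trans _ _ v).
    by apply: l1; rewrite ?c'v ?c'E //; apply: UU.
  by apply: l1; rewrite ?c'v ?c'E //; apply: UU.
- subst b; apply: (@connect_trans _ _ v).
    by apply: l1; rewrite ?c'v ?c'E //; apply: UU.
  by apply: l1; rewrite ?c'v ?c'E 1?es //; apply: UU.
Qed.

Section Step.
Variables (e : rel V) (W X : {set V}).
Hypotheses (es : symmetric e) (ei : irreflexive e) (mass : massed e W X).
Hypothesis IHW : forall e' W' X', symmetric e' -> irreflexive e' ->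
  massed e' W' X' -> #|W'| < #|W| -> linked e' (W' :|: X') X'.

(** A part of W that may be traded for a clique on its attachments S. *)
Definition rigid W1 S := [/\ W1 != set0, W1 \subset W, S \subset (W :|: X) :\: W1,
  closed_in e W1 S & linked e (W1 :|: S) S].

(* Take W1 maximal and replace it by a clique on S.  The new graph is massed: a
   violating set would contain a massed, hence linked, piece, and together with W1
   this piece would be a larger rigid set. *)
Lemma rigid_lt W1 S : rigid W1 S -> #|S| < #|X| -> linked e (W :|: X) X.
Proof.
move: mass => [WX cW X8 mW mass2].
pose P (p : {set V} * {set V}) := rigid p.1 p.2 /\ #|p.2| < #|X|.
move=> r1 lt1.
have [[W0 S0] [/= [[W0n W0W S0U cW0 lW0] lt0] maxW]] : exists p, P p /\
    forall p', P p' -> #|~: p.1| <= #|~: p'.1|.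
  by apply: (exists_minimum (P := P)); exists (W1, S).
rewrite /= in W0n W0W S0U cW0 lW0 lt0; move=> {W1 S r1 lt1}.
set e' := fill e W0 S0; pose W' := W :\: W0.
have e's : symmetric e' by apply: fill_sym.
have e'i : irreflexive e' by apply: fill_irrefl.
have ne a b : e a b -> a != b by apply: contraTneq => ->; rewrite ei.
have S0W z : z \in S0 -> z \notin W0.
  by move/(subsetP S0U); rewrite inE => /andP[].
have e'E a b : e a b -> a \notin W0 -> b \notin W0 -> e' a b.
  by move=> ab aW bW; rewrite /e' /fill aW bW ne // ab.
have ltW' : #|W'| < #|W|.
  case/set0Pn: W0n => z zW0; apply: proper_card; apply/properP; split; first exact: subsetDl.
  by exists z; rewrite ?inE ?zW0 // (subsetP W0W).
have cW' : closed_in e' W' X.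
  move=> w y; rewrite inE => /andP[wW0 wW] /and4P[_ yW0 _ /orP[wy|/andP[_ yS0]]].
    by have := cW _ _ wW wy; rewrite !inE yW0.
  by have := subsetP S0U _ yS0; rewrite !inE yW0.
have lW' : linked e' (W' :|: X) X; last first.
  have -> : W :|: X = (W' :|: X) :|: W0.
    apply/setP=> z; rewrite !inE; have [zW0|_] := boolP (z \in W0); rewrite ?orbT ?orbF //=.
    by rewrite (subsetP W0W).
  apply: (@linked_fill _ e W0 S0); rewrite ?subsetUr //.
    rewrite -setI_eq0; apply/eqP/setP=> y; rewrite !inE.
    have [yW0|//] := boolP (y \in W0); rewrite /=.
    by apply: (disjointFr WX); apply: (subsetP W0W).
  by apply/subsetP=> z /(subsetP S0U); rewrite !inE => /andP[-> /orP[->|->]]; rewrite ?orbT.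
apply: IHW => //; split=> //.
- by apply: disjointWl WX; apply: subsetDl.
(* Only edges meeting [W0] are lost. These are at most 15 per vertex of [W0], since its boundary
   lies in the small set [S0]. *)
- have b0 : arcs e W0 <= 30 * #|W0|.
    apply: mass2 => //; apply: leq_ltn_trans lt0; apply: subset_leq_card; exact: boundary_sub.
  have : arcs e W <= arcs e' W' + arcs e W0.
    rewrite /arcs; apply: leq_trans (leq_card_setU _ _); apply: subset_leq_card.
    apply/subsetP=> -[a b]; rewrite !inE /= => /andP[ab h].
    have [aW0|aW0] := boolP (a \in W0); first by rewrite ab orbT.
    have [bW0|bW0] := boolP (b \in W0); first by rewrite ab !orbT.
    by rewrite e'E //= h.
  have -> : #|W'| = #|W| - #|W0| by rewrite cardsD (setIidPr W0W).
  have := subset_leq_card W0W; lia.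
move=> W2 sW2 b2; rewrite leqNgt; apply/negP=> m2.
have [W3 [sW3 m3 b3]] : exists W', [/\ W' \subset W2, massed e' W' (boundary e' W') & #|boundary e' W'| <= #|boundary e' W2|].
  by apply: submassed => //; apply: leq_trans (ltnW b2) X8.
have sW3' : W3 \subset W' by apply: subset_trans sW3 sW2.
have lt3 : #|W3| < #|W| by apply: leq_ltn_trans ltW'; apply: subset_leq_card.
have l3 := IHW e's e'i m3 lt3.
have W3n := massed_neq0 m3.
have W3W0 z : z \in W3 -> z \notin W0 by move/(subsetP sW3'); rewrite inE => /andP[].
(* If [W3] misses [S0], filling adds no edge at [W3] and removes no vertex from its boundary, so
   [W3] violates [mass2]. Otherwise the clique on [S0] lies within [W3] and its boundary. *)
have [/existsP[z /andP[zW3 zS0]]|/existsPn no] := boolP [exists z in W3, z \in S0]; last first.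
  have no' z : z \in W3 -> z \notin S0 by move=> zW; have := no z; rewrite zW.
  case: m3 => _ _ _; rewrite ltnNge => /negP; case.
  apply: (@leq_trans (arcs e W3)).
    apply: subset_leq_card; apply/subsetP=> -[a b]; rewrite !inE /= => /andP[/and4P[_ _ _ h] ab].
    rewrite ab andbT; case/orP: h => // /andP[aS bS].
    by case/orP: ab => /no'; rewrite ?aS ?bS.
  apply: mass2; first by apply: subset_trans sW3' _; apply: subsetDl.
  apply: leq_ltn_trans (leq_ltn_trans b3 b2); apply: subset_leq_card.
  apply/subsetP=> y; rewrite inE => /andP[yW3 /existsP[w /andP[wW3 wy]]].
  apply: (in_boundary wW3) => //; apply: e'E => //; first exact: W3W0.
  apply/negP=> yW0; have := cW0 y w yW0; rewrite es => /(_ wy).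
  by rewrite inE (negPf (W3W0 _ wW3)) (negPf (no' _ wW3)).
have S0sub : S0 \subset W3 :|: boundary e' W3.
  apply/subsetP=> y yS0; rewrite in_setU; have [//|yW3] := boolP (y \in W3).
  rewrite (in_boundary zW3) // /e' /fill !S0W // zS0 yS0 orbT andbT /=.
  by apply: contraNneq yW3 => <-.
have bdW0 y : y \in boundary e' W3 -> y \notin W0 /\ y \in W :|: X.
  rewrite inE => /andP[yW3 /existsP[w /andP[wW3 wy]]]; split; first by case/and4P: wy.
  have := cW' _ _ (subsetP sW3' _ wW3) wy; rewrite !inE => /orP[/andP[_ ->]//|->].
  by rewrite orbT.
have dis : [disjoint W0 & W3 :|: boundary e' W3].
  rewrite -setI_eq0; apply/eqP/setP=> y; rewrite in_setI in_set0 in_setU.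
  apply/negP=> /andP[yW0 /orP[/W3W0|/bdW0[]]]; by rewrite yW0.
have lf := linked_fill es dis (subsetUr _ _) S0sub lW0 l3.
have PW : P (W3 :|: W0, boundary e' W3).
  split; last by apply: leq_ltn_trans b3 b2.
  split=> /=.
  - by case/set0Pn: W3n => w wW3; apply/set0Pn; exists w; rewrite inE wW3.
  - rewrite subUset W0W andbT; apply: subset_trans sW3' _; exact: subsetDl.
  - apply/subsetP=> y yb; have [yW0 yU] := bdW0 _ yb; rewrite in_setD yU andbT.
    by move: yb; rewrite inE in_setU => /andP[yW3 _]; rewrite negb_or yW3.
  - move=> w y; rewrite !in_setU => /orP[wW3|wW0] wy; last first.
      have := cW0 _ _ wW0 wy; rewrite in_setU => /orP[->|/(subsetP S0sub)]; first by rewrite orbT.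
      by rewrite in_setU => /orP[->//|->]; rewrite orbT.
    have [//|yW0] := boolP (y \in W0); rewrite ?orbT ?orbF //.
    have [//|yW3] := boolP (y \in W3).
    by rewrite (in_boundary wW3) // e'E // W3W0.
  - by rewrite setUAC.
have := maxW _ PW => /=; rewrite leqNgt => /negP; apply.
apply: proper_card; rewrite properEneq; apply/andP; split; last by rewrite setCS subsetUr.
case/set0Pn: W3n => w wW3; apply/eqP=> /setP/(_ w).
by rewrite !inE wW3 (W3W0 _ wW3).
Qed.

(** If |S| = |X|, then S is a hub by way of W1, and failing to join X to it yields a rigid set
    behind fewer vertices. *)
Lemma rigid_le W1 S : rigid W1 S -> #|S| <= #|X| -> linked e (W :|: X) X.
Proof.
move=> r1; rewrite leq_eqVlt => /orP[/eqP SX|]; last exact: rigid_lt r1.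
move: mass r1 => [WX cW X8 mW mass2] [W1n W1W SU cW1 l1].
have hb : hub e W1 S by move=> S' sS _; apply: linked_sub sS l1.
case: (hub_linked es WX cW X8 W1W _ cW1 _ hb) => //; first by rewrite SX.
case=> W2 [S2 [h1 h2 h3 h4 [h5 h6]]]; apply: (@rigid_lt W2 S2) => //.
Qed.

(** W2 contains a part that is massed with respect to its own boundary; being smaller than W it is
    linked by induction, and so it is rigid. *)
Lemma rigid_sub W2 : W2 \proper W -> 30 * #|W2| < arcs e W2 -> #|boundary e W2| <= #|X| ->
  linked e (W :|: X) X.
Proof.
move=> pW2 m2 b2; move: mass => [WX cW X8 mW mass2].
have [W3 [sW3 m3 b3]] := submassed m2 (leq_trans b2 X8).
have pW3 : W3 \proper W by apply: sub_proper_trans sW3 pW2.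
apply: (@rigid_le W3 (boundary e W3)); last exact: leq_trans b3 b2.
split.
- exact: massed_neq0 m3.
- exact: proper_sub.
- apply/subsetP=> y; rewrite !inE => /andP[-> /existsP[w /andP[wW3 wy]]].
  by have := cW _ _ (subsetP (proper_sub pW3) _ wW3) wy; rewrite inE.
- exact: closed_boundary.
- by apply: IHW => //; apply: proper_card.
Qed.

End Step.
End Massed.

(** * Reductions in a minimal counterexample *)

Section Reductions.
Variable V : finType.
Implicit Types (S T Q A U W X Y : {set V}) (l c : V -> nat).
Variables (e : rel V) (W X : {set V}).
Hypotheses (es : symmetric e) (ei : irreflexive e) (mass : massed e W X).
Hypothesis IHW : forall e' W' X', symmetric e' -> irreflexive e' ->
  massed e' W' X' -> #|W'| < #|W| -> linked e' (W' :|: X') X'.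
Hypothesis nl : ~ linked e (W :|: X) X.

Let ne a b : e a b -> a != b.
Proof. by apply: contraTneq => ->; rewrite ei. Qed.

Lemma linked_mono U U' Y : U \subset U' -> linked e U Y -> linked e U' Y.
Proof.
move=> sU h l /h[c cl cc]; exists c => // x y xY yY /(cc x y xY yY).
apply: connect_subrel => a b /and4P[ab cab aU bU].
by rewrite /color_rel ab cab !(subsetP sU).
Qed.

Lemma boundary_ge2 : 2 <= #|X|.
Proof. by rewrite ltnNge; apply/negP=> /linked1 h; apply: nl. Qed.

(* Otherwise contracting uv loses at most 15 edges, and the result is massed. *)
Lemma contract_bound u v : v \in W -> u \in W :|: X -> e u v ->
  16 <= #|[set w | e v w && [|| w == u, e u w | (w \in X) && (u \in X)]]|.
Proof.
(* [B] collects the edges at v that contraction loses: uv itself, those that merge with an edge at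
   u, and those that end up inside X. *)
move=> vW uU uv; set B := [set w | _]; rewrite leqNgt; apply/negP=> B16.
move: mass => [WX cW X8 mW mass2].
set e' := contract e u v; pose W' := W :\ v.
have e's : symmetric e' by apply: contract_sym.
have e'i : irreflexive e' by apply: contract_irrefl.
have nuv := ne uv.
have vX : v \notin X by rewrite (disjointFr WX vW).
have eU : W :|: X = v |: (W' :|: X) by rewrite setUA /W' setD1K.
have vU' : v \notin W' :|: X by rewrite !inE eqxx.
have uU' : u \in W' :|: X by move: uU; rewrite !inE nuv.
have W'lt : #|W'| < #|W| by rewrite [#|W|](cardsD1 v) vW.
have cW' : closed_in e' W' X.
  move=> w y; rewrite !inE => /andP[wv wW] /and4P[_ yv _]; rewrite yv /=.
  case/or3P=> [wy|/andP[_ vy]|/andP[/eqP-> _]]; last by move: uU; rewrite inE.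
    by have := cW _ _ wW wy; rewrite inE.
  by have := cW _ _ vW vy; rewrite inE.
have e'E a b : e a b -> a != v -> b != v -> e' a b.
  by move=> ab av bv; rewrite /e' /contract av bv ne // ab.
apply: nl; rewrite eU; apply: (linked_contract es uv uU' vU'); rewrite ?subsetUr //.
apply: IHW => //; split=> //.
- by apply: disjointWl WX; apply: subsetDl.
- have : arcs e W <= arcs e' W' + 2 * #|B|.
    pose T3 := setX [set v] B :|: setX B [set v].
    have T3c : #|T3| <= 2 * #|B|.
      by apply: leq_trans (leq_card_setU _ _) _; rewrite !cardsX cards1; lia.
    (* Redirecting v to u is injective on the arcs that do not run between v and [B]. *)
    pose f (p : V * V) := (if p.1 == v then u else p.1, if p.2 == v then u else p.2).
    rewrite /arcs -(cardsID T3 (arcset e W)) addnC leq_add //; last first.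
      by apply: leq_trans T3c; apply: subset_leq_card; apply: subsetIr.
    have Bu w : e v w -> w \notin B -> [/\ w != u, ~~ e u w & ~~ ((w \in X) && (u \in X))].
      by move=> vw; rewrite inE vw /= !negb_or => /and3P[].
    have nT3 a b : (a, b) \notin T3 -> (a == v -> b \notin B) /\ (b == v -> a \notin B).
      rewrite !inE /= negb_or => /andP[h1 h2]; split=> h.
        by move: h1; rewrite h.
      by move: h2; rewrite h andbT.
    rewrite -(card_in_imset (f := f)).
      apply: subset_leq_card; apply/subsetP=> _ /imsetP[[a b] h ->]; move: h.
      rewrite in_setD => /andP[/nT3[aB bB]]; rewrite inE /= => /andP[ab tW].
      have nab := ne ab.
      rewrite /f /= inE /=; case: (eqVneq a v) aB bB => [av aB _|av _].
        rewrite av in ab nab tW *; have [bu nub nX] := Bu b ab (aB isT).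
        rewrite eq_sym (negPf nab) /e' /contract nuv eq_sym nab eq_sym bu eqxx ab orbT /=.
        rewrite /W' !inE nuv eq_sym nab.
        have := cW _ _ vW ab; move: nX uU; rewrite !inE.
        by case: (b \in W) => //=; rewrite ?orbT //; case: (u \in W) => //= nX uX bX; rewrite bX uX in nX.
      case: (eqVneq b v) => [bv bB|bv _].
        rewrite bv in ab; have va : e v a by rewrite es.
        have [au nua nX] := Bu a va (bB isT).
        rewrite /e' /contract nuv av au eqxx ab !orbT /=.
        rewrite /W' !inE nuv av.
        have := cW _ _ vW va; move: nX uU; rewrite !inE.
        by case: (a \in W) => //=; case: (u \in W) => //= nX uX aX; rewrite aX uX in nX.
      by rewrite e'E //= /W' !inE av bv.
    move=> [a b] [a' b']; rewrite !in_setD => /andP[/nT3[aB bB]]; rewrite inE /= => /andP[ab _].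
    case/andP=> /nT3[aB' bB']; rewrite inE /= => /andP[ab' _]; rewrite /f /= => -[].
    have nab := ne ab; have nab' := ne ab'.
    case: (eqVneq a v) aB ab nab => [->|av] aB ab nab; case: (eqVneq a' v) aB' ab' nab' => [->|av'] aB' ab' nab'.
    + by rewrite eq_sym (negPf nab) eq_sym (negPf nab') => _ ->.
    + have [bu nub _] := Bu b ab (aB isT).
      rewrite eq_sym (negPf nab) => ua'; case: eqP => [_ eb|bv' eb]; first by rewrite eb eqxx in bu.
      by rewrite ua' eb ab' in nub.
    + have [bu nub _] := Bu b' ab' (aB' isT).
      rewrite [b' == v]eq_sym (negPf nab') => ua'; case: eqP => [_ eb|bv' eb]; first by rewrite eb eqxx in bu.
      by rewrite -ua' -eb ab in nub.
    + move=> eaa; case: (eqVneq b v) bB ab => [->|bv] bB ab; case: (eqVneq b' v) bB' ab' => [->|bv'] bB' ab'.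
      * by rewrite eaa.
      * move=> eb; have [au nua _] := Bu a ltac:(by rewrite es) (bB isT).
        by rewrite es eaa eb ab' in nua.
      * move=> eb; have [au nua _] := Bu a' ltac:(by rewrite es) (bB' isT).
        by rewrite es -eaa -eb ab in nua.
      * by move=> ->; rewrite eaa.
  have : #|W| = #|W'|.+1 by rewrite [#|W|](cardsD1 v) vW.
  by rewrite -/e'; move: mW B16; clear; lia.
move=> W2 sW2; rewrite -/e' => b2; rewrite leqNgt; apply/negP=> m2.
have [W3 [sW3 m3 b3]] : exists W', [/\ W' \subset W2, massed e' W' (boundary e' W') & #|boundary e' W'| <= #|boundary e' W2|].
  by apply: submassed => //; apply: leq_trans (ltnW b2) X8.
have sW3' : W3 \subset W' by apply: subset_trans sW3 sW2.
have lt3 : #|W3| < #|W| by apply: leq_ltn_trans W'lt; apply: subset_leq_card.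
have l3 := IHW e's e'i m3 lt3.
have W3v z : z \in W3 -> z != v /\ z \in W by move/(subsetP sW3'); rewrite !inE => /andP[].
have bdv : v \notin boundary e' W3.
  rewrite inE; apply/negP=> /andP[_ /existsP[w /andP[_ /and4P[_]]]]; by rewrite eqxx.
(* If the contracted vertex lies in [W3], adding v back gives a rigid set with the same attachments.
   If not, v may be a new boundary vertex of [W3], for which the strict bound [b2] leaves room. *)
have [uW3|uW3] := boolP (u \in W3).
  apply: nl; apply: (@rigid_lt _ e W X es ei mass IHW (v |: W3) (boundary e' W3)).
    split.
    - by apply/set0Pn; exists v; rewrite !inE eqxx.
    - by rewrite subUset sub1set vW; apply/subsetP=> z /W3v[].
    - apply/subsetP=> y yb; rewrite in_setD.
      have yv : y != v by apply: contraNneq bdv => <-.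
      move: yb; rewrite inE => /andP[yW3 /existsP[w /andP[wW3 wy]]].
      rewrite in_setU1 negb_or yv yW3 /=.
      by have := cW' _ _ (subsetP sW3' _ wW3) wy; rewrite !inE => /orP[/andP[_ ->]|->]; rewrite ?orbT.
    - move=> w y; rewrite !in_setU1 => wW wy; rewrite in_setU in_setU1.
      have [//|yv] := eqVneq y v; have [//|yW3] := boolP (y \in W3).
      rewrite /=; case/orP: wW => [/eqP ew|wW3]; last first.
        by rewrite (in_boundary wW3) // e'E //; case: (W3v _ wW3).
      rewrite ew in wy; rewrite (in_boundary uW3) // /e' /contract nuv yv wy eqxx !orbT andbT.
      by apply: contraNneq yW3 => <-.
    - rewrite -setUA; apply: linked_contract es uv _ _ _ l3; rewrite ?subsetUr //.
        by rewrite in_setU uW3.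
      by rewrite in_setU negb_or bdv andbT; apply/negP=> /W3v[]; rewrite eqxx.
  exact: leq_ltn_trans b3 b2.
apply: nl; apply: (@rigid_sub _ e W X es ei mass IHW W3).
- by apply: sub_proper_trans sW3' _; apply: properD1.
- case: m3 => _ _ _ m3 _; apply: leq_trans m3 _.
  pose f (p : V * V) := if e p.1 p.2 then p else if p.1 == u then (v, p.2) else (p.1, v).
  rewrite /arcs -(card_in_imset (f := f)).
    apply: subset_leq_card; apply/subsetP=> _ /imsetP[[a b] h ->]; move: h.
    rewrite !inE /f /= => /andP[/and4P[av bv _ h] ab].
    case: ifP h => [-> _|_ /= h] //=.
    case: eqP h ab => [-> h|_ /= /andP[/eqP-> ->]] /=; last by rewrite (negPf uW3) orbF => ->.
    rewrite (negPf uW3) /= => bW3; rewrite bW3 orbT andbT.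
    case/orP: h => [//|/andP[/eqP eb _]].
    by rewrite eb (negPf uW3) in bW3.
  move=> [a b] [a' b']; rewrite !inE /f /= => /andP[/and4P[av bv _ h] ab] /andP[/and4P[av' bv' _ h'] ab'].
  case: (boolP (e a b)) h => [eab _|_ /= h]; case: (boolP (e a' b')) h' => [eab' _|_ /= h'] //.
  - case: eqP => _ [e1 e2]; first by rewrite e1 eqxx in av.
    by rewrite e2 eqxx in bv.
  - case: eqP => _ [e1 e2]; first by rewrite -e1 eqxx in av'.
    by rewrite -e2 eqxx in bv'.
  - case: eqP h => [-> h|_ /= /andP[/eqP-> _]]; case: eqP h' => [-> h'|_ /= /andP[/eqP-> _]].
    + by case=> ->.
    + by case=> e1 e2; rewrite -e1 eqxx in av'.
    + by case=> e1 e2; rewrite e1 eqxx in av.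
    + by case=> ->.
- apply: (@leq_trans #|v |: boundary e' W3|).
    apply: subset_leq_card; apply/subsetP=> y; rewrite [y \in boundary e W3]inE in_setU1.
    case/andP=> yW3 /existsP[w /andP[wW3 wy]].
    have [//|yv] := eqVneq y v; rewrite /= (in_boundary wW3) // e'E //; by case: (W3v _ wW3).
  by rewrite cardsU1 bdv add1n; apply: leq_ltn_trans b3 b2.
Qed.

(** An isolated vertex contributes no edge, so W without it is massed and smaller. This supplies a
    first neighbour to which [contract_bound] can be applied. *)
Lemma no_isolated v : v \in W -> exists y, e v y.
Proof.
move=> vW; apply: NNPP => no; move: mass => [WX cW X8 mW mass2].
have nv y : ~~ e v y by apply/negP=> h; apply: no; exists y.
have W'W : W :\ v \subset W by apply: subsetDl.
have cardW : #|W| = #|W :\ v|.+1 by rewrite [#|W|](cardsD1 v) vW.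
apply: nl; apply: (@linked_mono (W :\ v :|: X)); first exact: setSU.
apply: IHW => //; last by rewrite cardW.
split=> //.
- exact: disjointWl WX.
- move=> w y; rewrite !inE => /andP[wv wW] wy; have := cW _ _ wW wy; rewrite inE.
  case: (eqVneq y v) => // yv; by move: wy; rewrite yv es (negPf (nv _)).
- apply: (@leq_trans (arcs e W)); first by move: mW; rewrite cardW; lia.
  apply: subset_leq_card; apply/subsetP=> -[a b]; rewrite !inE /= => /andP[ab h].
  rewrite ab /=.
  have -> : a != v by apply: contraTneq ab => ->; apply: nv.
  by have -> : b != v by apply: contraTneq ab => ->; rewrite es; apply: nv.
- by move=> W2 sW2; apply: mass2; apply: subset_trans sW2 W'W.
Qed.

(* The vertices with a neighbour in X exceed the average of deg v + |N(v) & X|; if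
   every vertex failed, there would be at most two of these, and they would
   separate the rest of W from X. *)
Lemma low_vertex : arcs e W <= 30 * #|W| + 2 ->
  exists2 v, v \in W & #|[set y | e v y]| <= 29 /\
   #|[set y | e v y]| + #|[set y in X | e v y]| <= 30.
Proof.
move=> aW; move: mass => [WX cW X8 mW mass2].
pose d v := #|[set y | e v y]|; pose x v := #|[set y in X | e v y]|.
(* Arcs that start in W are counted by [d], and those from X to W by [x]. *)
have sumf : \sum_(v in W) (d v + x v) <= arcs e W.
  rewrite big_split /= /arcs -(cardsID [set p | p.1 \in W] (arcset e W)); apply: leq_add.
    rewrite (eq_bigr (fun a => \sum_(b | e a b) 1)); last by move=> a _; rewrite sum1dep_card.
    rewrite pair_big_dep /= sum1dep_card; apply: subset_leq_card; apply/subsetP=> p.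
    by rewrite !inE => /andP[-> ->].
  rewrite (eq_bigr (fun a => \sum_(b | (b \in X) && e a b) 1)); last by move=> a _; rewrite sum1dep_card.
  rewrite pair_big_dep /= sum1dep_card.
  rewrite -(card_imset (f := fun p : V * V => (p.2, p.1))); last by move=> [a b] [a' b'] [-> ->].
  apply: subset_leq_card; apply/subsetP=> _ /imsetP[[a b] h ->]; move: h; rewrite !inE /=.
  by case/and3P=> aW' bX ab; rewrite es ab aW' orbT !andbT (disjointFl WX bX).
apply: NNPP => no.
(* A vertex with a neighbour in X fails only with a sum of at least 31: if its degree alone is 30,
   that neighbour adds one. *)
have big v : v \in W -> 30 + (0 < x v) <= d v + x v.
  move=> vW; rewrite leqNgt; apply/negP=> h; apply: no; exists v => //.
  by move: h; rewrite -/(d v) -/(x v); lia.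
pose WX' := [set v in W | 0 < x v].
have WX2 : #|WX'| <= 2.
  have : \sum_(v in W) (30 + (0 < x v)) <= \sum_(v in W) (d v + x v) by apply: leq_sum.
  rewrite big_split /= sum_nat_const.
  have -> : \sum_(v in W) (0 < x v : nat) = #|WX'|.
    rewrite -sum1dep_card big_mkcondr /=; apply: eq_bigr => v _; by case: (0 < x v).
  lia.
pose W' := W :\: WX'.
have bW' : boundary e W' \subset WX'.
  apply/subsetP=> y; rewrite inE => /andP[yW' /existsP[w /andP[wW' wy]]].
  move: wW'; rewrite in_setD => /andP[wX wW].
  have yX : y \notin X.
    apply/negP=> yX; move: wX; rewrite inE wW /= -leqNgt leqn0 cards_eq0 => /eqP/setP/(_ y).
    by rewrite !inE yX wy.
  have := cW _ _ wW wy; rewrite in_setU (negPf yX) orbF => yW.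
  by move: yW'; rewrite in_setD yW andbT negbK.
have WX'W : WX' \subset W by apply/subsetP=> z; rewrite inE => /andP[].
have cardW : #|W| = #|W'| + #|WX'|.
  by rewrite -(cardsID WX' W) addnC (setIidPr WX'W).
(* 18 = (2 + 8) + 8: arcs from a vertex of [WX'] to [WX'] and X, and arcs back from X. As 18 < 30,
   [W'] still has too many edges. *)
have aW' : arcs e W <= arcs e W' + 18 * #|WX'|.
  have h : arcset e W \subset arcset e W' :|: (setX WX' (WX' :|: X) :|: setX X WX').
    apply/subsetP=> -[a b]; rewrite !in_setU !in_setX !in_setU ![(a, b) \in _]inE /= !in_setD => /andP[ab h].
    rewrite ab /=; have ba : e b a by rewrite es.
    have cc z z' : z \in W -> e z z' -> (z' \in W) || (z' \in X).
      by move=> zW zz'; have := cW _ _ zW zz'; rewrite inE.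
    have WX'W' z : z \in WX' -> z \in W by apply: (subsetP WX'W).
    case/orP: h => hW.
      have := cc _ _ hW ab; case: (boolP (a \in WX')) => aX; last by rewrite hW.
      rewrite /=; case: (boolP (b \in WX')) => bX; rewrite ?orbT //= => /orP[->|->]; rewrite ?orbT //.
    have := cc _ _ hW ba; case: (boolP (b \in WX')) => bX; last by rewrite hW orbT.
    case: (boolP (a \in WX')) => aX; rewrite ?orbT //= => /orP[->|->]; rewrite ?orbT //.
  apply: leq_trans (subset_leq_card h) _; apply: leq_trans (leq_card_setU _ _) _.
  rewrite leq_add2l; apply: leq_trans (leq_card_setU _ _) _; rewrite !cardsX.
  have [+ _] := leq_card_setU WX' X; rewrite [#|X| * _]mulnC -mulnDr [18 * _]mulnC.
  by move=> h1; rewrite leq_mul2l; apply/orP; right; lia.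
have [WX0|WX0] := posnP #|WX'|.
  have eW : W' = W by rewrite /W' (cards0_eq WX0) setD0.
  have : arcs e W <= 30 * #|W|.
    apply: mass2 => //; rewrite -eW; apply: leq_ltn_trans (subset_leq_card bW') _.
    by rewrite WX0; have := boundary_ge2; lia.
  lia.
apply: nl; apply: (@rigid_sub _ e W X es ei mass IHW W').
- rewrite properEcard subsetDl /=; lia.
- lia.
- apply: leq_trans (subset_leq_card bW') _; have := boundary_ge2; lia.
Qed.

Hypothesis IHE : forall e', symmetric e' -> irreflexive e' -> massed e' W X ->
  arcs e' W < arcs e W -> linked e' (W :|: X) X.

Lemma linked_subrel e' U Y : subrel e' e -> linked e' U Y -> linked e U Y.
Proof.
move=> sub h l /h[c cl cc]; exists c => // x y xY yY /(cc x y xY yY).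
apply: connect_subrel => a b /and4P[ab cab aU bU].
by rewrite /color_rel sub // cab aU bU.
Qed.

(** With more than 30|W| + 2 arcs, an edge inside W can be deleted and the total stays large enough.
    A part that now violates massedness contains exactly one end of the edge, and its boundary in
    the full graph has at most one more vertex, which [rigid_sub] excludes. If W spans no edge,
    there are at most 16|W| arcs. *)
Lemma arcs_bound : arcs e W <= 30 * #|W| + 2.
Proof.
rewrite leqNgt; apply/negP=> aW; move: mass => [WX cW X8 mW mass2].
have [x [y [xW yW xy]]] : exists x y, [/\ x \in W, y \in W & e x y].
  apply: NNPP => no.
  have h : arcset e W \subset setX W X :|: setX X W.
    apply/subsetP=> -[a b]; rewrite in_setU !in_setX ![(a, b) \in _]inE /= => /andP[ab h].
    have ba : e b a by rewrite es.
    case/orP: h => hW.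
      have := cW _ _ hW ab; rewrite in_setU hW => /orP[bW|->]; last by [].
      by case: no; exists a, b.
    have := cW _ _ hW ba; rewrite in_setU hW => /orP[bW|->]; last by rewrite orbT.
    by case: no; exists a, b.
  have := leq_trans (subset_leq_card h) (leq_card_setU _ _); rewrite !cardsX -/(arcs e W).
  by have := leq_mul (leqnn #|W|) X8; rewrite [#|X| * _]mulnC; move: (#|W| * #|X|) => m; lia.
set e' := del e x y.
have e's : symmetric e' by apply: del_sym.
have sub : subrel e' e by move=> a b /andP[].
have e'i : irreflexive e' by move=> a; apply/negP=> /sub; rewrite ei.
have le2 : arcs e W <= arcs e' W + 2.
  have h : arcset e W \subset arcset e' W :|: [set (x, y); (y, x)].
    apply/subsetP=> -[a b]; rewrite !inE /= => /andP[ab h]; rewrite h /e' /del ab /= !xpair_eqE.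
    by rewrite andbT orNb.
  apply: leq_trans (subset_leq_card h) _; apply: leq_trans (leq_card_setU _ _) _.
  by rewrite leq_add2l cards2; case: (_ != _).
have lt2 : arcs e' W < arcs e W.
  apply: proper_card; apply/properP; split.
    by apply/subsetP=> p; rewrite !inE => /andP[/sub-> ->].
  by exists (x, y); rewrite !inE /= ?xy ?xW // /e' /del !eqxx andbF.
apply: nl; apply: (@linked_subrel e') => //; apply: IHE => //; split=> //.
- by move=> w z wW /sub; apply: cW.
- lia.
move=> W2 sW2 b2; rewrite leqNgt; apply/negP=> m2.
have le : arcs e' W2 <= arcs e W2.
  by apply: subset_leq_card; apply/subsetP=> p; rewrite !inE => /andP[/sub-> ->].
have bdsub z : z \in boundary e W2 -> z \notin boundary e' W2 ->
    (z == y) && (x \in W2) || (z == x) && (y \in W2).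
  rewrite !inE => /andP[zW2 /existsP[w /andP[wW2 wz]]]; rewrite zW2 /= => /existsPn/(_ w).
  rewrite wW2 /e' /del wz /= negbK => /orP[]/andP[/eqP ew /eqP ez]; rewrite -ew wW2 ez eqxx //.
  by rewrite orbT.
have [exy|nxy] := eqVneq (x \in W2) (y \in W2).
  have : arcs e W2 <= 30 * #|W2|; last by lia.
  apply: mass2 => //; apply: leq_ltn_trans b2; apply: subset_leq_card; apply/subsetP=> z zb.
  apply: contraT => /(bdsub _ zb); move: zb; rewrite inE => /andP[zW2 _].
  by case/orP=> /andP[/eqP ez h]; move: zW2; rewrite ez; [rewrite -exy h|rewrite exy h].
apply: nl; apply: (@rigid_sub _ e W X es ei mass IHW W2).
- rewrite properE sW2 /=; apply/subsetPn.
  by have [xW2|xW2] := boolP (x \in W2); [exists y => //; move: nxy; rewrite xW2; case: (y \in W2)| exists x].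
- lia.
- apply: (@leq_trans #|(if x \in W2 then y else x) |: boundary e' W2|); last first.
    by rewrite cardsU1; move: b2; case: (_ \notin _); lia.
  apply: subset_leq_card; apply/subsetP=> z zb; rewrite in_setU1.
  have [|/(bdsub _ zb)] := boolP (z \in boundary e' W2); first by rewrite orbT.
  rewrite orbF; case: ifP nxy => xW2; case: (y \in W2) => //= _; by rewrite ?andbT ?andbF ?orbF.
Qed.

End Reductions.

(** * Linking four pairs in a nearly complete graph *)

Section Pairs.
Variable V : finType.
Implicit Types (S T Q A U W X Y Z R D K : {set V}) (l c : V -> nat) (p q : V * V) (L : seq (V * V)).

Definition terms L : seq V := flatten [seq [:: p.1; p.2] | p <- L].

Lemma terms_cons p L : terms (p :: L) = p.1 :: p.2 :: terms L.
Proof. by []. Qed.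

Lemma size_terms L : size (terms L) = 2 * size L.
Proof. by elim: L => //= p L IH; rewrite -/(terms L) IH; lia. Qed.

Lemma mem_terms z L : reflect (exists2 p, p \in L & (z == p.1) || (z == p.2)) (z \in terms L).
Proof.
apply: (iffP flatten_mapP) => -[p pL h]; exists p => //.
  by move: h; rewrite !inE.
by rewrite !inE.
Qed.

Lemma term1 p L : p \in L -> p.1 \in terms L.
Proof. by move=> pL; apply/mem_terms; exists p; rewrite // eqxx. Qed.

Lemma term2 p L : p \in L -> p.2 \in terms L.
Proof. by move=> pL; apply/mem_terms; exists p; rewrite // eqxx orbT. Qed.

Lemma terms_perm L L' : perm_eq L L' -> perm_eq (terms L) (terms L').
Proof. by move=> h; apply: perm_flatten; apply: perm_map. Qed.

Lemma terms_inj L p q z : uniq (terms L) -> p \in L -> q \in L ->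
  (z == p.1) || (z == p.2) -> (z == q.1) || (z == q.2) -> p = q.
Proof.
elim: L => // p0 L IH; rewrite terms_cons /= inE negb_or => /and3P[/andP[h1 h2] h3 u].
have no p' : p' \in L -> (z == p'.1) || (z == p'.2) -> (z == p0.1) || (z == p0.2) -> False.
  move=> p'L hp' /orP[]/eqP e0; [case/negP: h2|case/negP: h3];
  by rewrite -e0; apply/mem_terms; exists p'.
rewrite !inE => /orP[/eqP->|pL] /orP[/eqP->|qL] hp hq //.
- by case: (no q).
- by case: (no p).
- exact: IH.
Qed.

Lemma terms_neq L p : uniq (terms L) -> p \in L -> p.1 != p.2.
Proof.
elim: L => // p0 L IH; rewrite terms_cons /= inE negb_or => /and3P[/andP[h1 _] _ u].
by rewrite inE => /orP[/eqP->//|]; apply: IH.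
Qed.

Lemma terms_uniq L : uniq (terms L) -> uniq L.
Proof.
elim: L => // p L IH; rewrite terms_cons /= inE negb_or => /and3P[/andP[_ h] _ u].
by rewrite IH // andbT; apply: contra h; apply: term1.
Qed.

Lemma terms_filter (a : pred (V * V)) L : uniq (terms L) -> uniq (terms (filter a L)).
Proof.
apply: subseq_uniq; elim: L => // p L IH /=; case: ifP => _; rewrite /= -/(terms L).
  by rewrite -/(terms (filter a L)) !eqxx.
exact: subseq_trans IH (suffix_subseq [:: p.1; p.2] (terms L)).
Qed.

Definition linkable e R L := exists C : V * V -> {set V},
  (forall p, p \in L -> [/\ C p \subset R, p.1 \in C p, p.2 \in C p &
     connect (restr e (C p)) p.1 p.2]) /\
  (forall p q, p \in L -> q \in L -> p != q -> [disjoint C p & C q]).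

(** The labels prescribe a partial matching of S0, here completed to a perfect matching of S. *)
Lemma pairing l k S S0 : #|S| = 2 * k -> S0 \subset S -> atmost2 S0 l ->
  exists L, [/\ size L = k, uniq (terms L), terms L =i S &
    forall x y, x \in S0 -> y \in S0 -> x != y -> l x = l y -> (x, y) \in L \/ (y, x) \in L].
Proof.
elim: k S S0 => [|k IH] S S0 Sk sS h2.
  have S0e : S = set0 by apply: cards0_eq; rewrite Sk muln0.
  exists [::]; split=> // [z|x y]; first by rewrite S0e inE.
  by move/(subsetP sS); rewrite S0e inE.
have step x y S1 : x \in S -> y \in S -> x != y -> S1 \subset S :\ x :\ y -> atmost2 S1 l ->
    exists L, [/\ size L = k.+1, uniq (terms L), terms L =i S, (x, y) \in L &
    forall x' y', x' \in S1 -> y' \in S1 -> x' != y' -> l x' = l y' -> (x', y') \in L \/ (y', x') \in L].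
  move=> xS yS xy sS1 h21.
  have ySx : y \in S :\ x by rewrite !inE eq_sym xy.
  have ck : #|S :\ x :\ y| = 2 * k.
    by move: Sk; rewrite (cardsD1 x) xS (cardsD1 y) ySx; lia.
  have [L [sL uL tL cL]] := IH _ _ ck sS1 h21.
  exists ((x, y) :: L); split=> /=; rewrite ?sL ?inE ?eqxx //.
  - by rewrite -/(terms L) !tL !inE !eqxx (negPf xy) uL.
  - move=> z; rewrite -/(terms L) !inE tL !inE.
    have [->|zx] := eqVneq z x; first by rewrite xS.
    by have [->|zy] := eqVneq z y; first by rewrite yS.
  - by move=> x' y' a1 a2 a3 a4; rewrite !inE; case: (cL x' y') => // ->; rewrite orbT; [left|right].
have [/existsP[x /existsP[y /and4P[xS0 yS0 xy /eqP lxy]]]|/existsPn no] :=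
    boolP [exists x, exists y, [&& x \in S0, y \in S0, x != y & l x == l y]].
  have s1 : S0 :\ x :\ y \subset S :\ x :\ y by rewrite !setSD.
  have h21 : atmost2 (S0 :\ x :\ y) l.
    by apply: atmost2_sub h2; apply: subset_trans (subsetDl _ _) (subsetDl _ _).
  have [L [sL uL tL xyL cL]] := step x y _ (subsetP sS _ xS0) (subsetP sS _ yS0) xy s1 h21.
  exists L; split=> // x' y' x'S y'S xy' lxy'.
  have third z : z \in S0 -> l z = l x -> (z == x) || (z == y).
    move=> zS lz; apply: contraT; rewrite negb_or => /andP[zx zy].
    have := h2 (l x); rewrite leqNgt => /negP; case.
    apply: (@leq_trans #|z |: [set x; y]|).
      by rewrite cardsU1 cards2 !inE negb_or zx zy xy.
    apply: subset_leq_card; apply/subsetP=> w; rewrite !inE => /or3P[]/eqP->;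
    by rewrite ?zS ?xS0 ?yS0 ?lz ?lxy eqxx.
  have [lx|lx] := eqVneq (l x') (l x).
    have lx2 : l y' = l x by rewrite -lxy'.
    case/orP: (third _ x'S lx) => /eqP ex; case/orP: (third _ y'S lx2) => /eqP ey; subst.
    + by rewrite eqxx in xy'.
    + by left.
    + by right.
    + by rewrite eqxx in xy'.
  apply: cL => //; rewrite !inE ?x'S ?y'S andbT.
    by apply/andP; split; apply: contraNneq lx => ->; rewrite ?lxy.
  by rewrite lxy' in lx; apply/andP; split; apply: contraNneq lx => ->; rewrite ?lxy.
have : 1 < #|S| by rewrite Sk; lia.
case/card_gt1P=> x [y [xS yS xy]].
have [||L [sL uL tL xyL cL]] := step x y set0 xS yS xy; first exact: sub0set.
  by apply: atmost2_sub h2; apply: sub0set.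
exists L; split=> // x' y' x'S y'S xy' lxy'.
have := no x'; rewrite negb_exists => /forallP/(_ y').
by rewrite x'S y'S xy' lxy' eqxx.
Qed.

Variable e : rel V.
Hypothesis es : symmetric e.

(** Fewer than eight vertices are padded with others of Q and paired off completely, which leaves
    only the case of four disjoint pairs. *)
Lemma hub_of_linkable D Q : 8 <= #|Q| ->
  (forall L, size L = 4 -> uniq (terms L) -> {subset terms L <= Q} -> linkable e (D :|: Q) L) ->
  hub e D Q.
Proof.
move=> Q8 lk S SQ S8 l l2.
have [S1 [sS1 S1Q c1]] : exists S1 : {set V}, [/\ S \subset S1, S1 \subset Q & #|S1| = 8].
  have [B sB cB] : exists2 B : {set V}, B \subset Q :\: S & #|B| = 8 - #|S|.
    by apply: ex_subset_card; rewrite cardsD (setIidPr SQ); lia.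
  exists (S :|: B); split; first exact: subsetUl.
    by rewrite subUset SQ; apply: subset_trans sB (subsetDl _ _).
  rewrite cardsU cB; have -> : S :&: B = set0; last by rewrite cards0; lia.
  by apply/setP=> z; rewrite !inE; apply/negP=> /andP[zS /(subsetP sB)]; rewrite inE zS.
have [L [sL uL tL cL]] := @pairing l 4 S1 S c1 sS1 l2.
have [C [hC dC]] : linkable e (D :|: Q) L.
  by apply: lk => // z; rewrite tL; apply: (subsetP S1Q).
have memC p z : p \in L -> z \in S -> z \in C p -> (z == p.1) || (z == p.2).
  move=> pL zS zC; have : z \in terms L by rewrite tL (subsetP sS1).
  case/mem_terms=> q qL hz; have [->//|pq] := eqVneq p q.
  have [_ q1 q2 _] := hC _ qL.
  have zCq : z \in C q by case/orP: hz => /eqP->.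
  by have := dC _ _ pL qL pq => /disjointFr/(_ zC); rewrite zCq.
pose c z := if z \in S then l z else
  if [pick p in L | z \in C p] is Some p then l p.1 else 0.
have key x y : x \in S -> y \in S -> l x = l y -> (x, y) \in L -> connect (color_rel e c (D :|: Q)) x y.
  move=> xS yS lxy xyL; have [CR /= xC yC cxy] := hC _ xyL.
  apply: connect_subrel cxy => a b /and3P[ab aC bC].
  have cC z : z \in C (x, y) -> c z = l x.
    move=> zC; rewrite /c; case: ifP => [zS|_].
      by case/orP: (memC _ _ xyL zS zC) => /eqP->.
    case: pickP => [q /andP[qL zq]|/(_ (x, y))]; last by rewrite xyL zC.
    have [->//|pq] := eqVneq q (x, y).
    by have := dC _ _ qL xyL pq => /disjointFr/(_ zq); rewrite zC.
  by rewrite /color_rel ab !cC // eqxx !(subsetP CR).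
exists c => [x xS|x y xS yS lxy]; first by rewrite /c xS.
have [->|xy] := eqVneq x y; first exact: connect0.
case: (cL x y xS yS xy lxy) => h; first exact: key.
rewrite connect_sym_of; last exact: color_rel_sym.
exact: key.
Qed.

Lemma connect_edge (C : {set V}) x y : e x y -> x \in C -> y \in C -> connect (restr e C) x y.
Proof. by move=> xy xC yC; apply: connect1; rewrite /restr xy xC yC. Qed.

(* K consists of Z and the vertices of Y complete to Z.  A nonadjacent pair inside
   Z is joined through any free vertex of K, one inside Y through a free vertex of Z. *)
Lemma near_complete Z Y : [disjoint Z & Y] -> 8 <= #|Z| ->
  (forall z, z \in Z -> #|[set a in Z :|: Y | (a != z) && ~~ e z a]| <= 1) ->
  15 + #|[set z in Z | [exists a in Z :|: Y, (a != z) && ~~ e z a]]| <= 2 * #|Z| + #|Y| ->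
  exists K, [/\ K \subset Z :|: Y, 8 <= #|K| & hub e set0 K].
Proof.
move=> ZY Z8 miss cnt; set Um := [set z in Z | _] in cnt.
pose Y' := [set y in Y | [forall z in Z, e z y]].
pose UZ := [set z in Z | [exists a in Z, (a != z) && ~~ e z a]].
have Y'Y y : y \in Y' -> y \in Y by rewrite inE => /andP[].
have Y'e y z : y \in Y' -> z \in Z -> e z y.
  by rewrite inE => /andP[_ /forallP/(_ z)/implyP h zZ]; apply: h.
have ZnY z : z \in Z -> z \notin Y by move=> zZ; rewrite (disjointFr ZY zZ).
have one z a b : z \in Z -> a \in Z :|: Y -> b \in Z :|: Y -> a != z -> b != z ->
    ~~ e z a -> ~~ e z b -> a = b.
  move=> zZ aU bU az bz za zb; have /card_le1_eqP := miss z zZ; apply; by rewrite !inE -in_setU ?aU ?bU ?az ?bz.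
(* Charge each vertex of Y that is not complete to Z to a vertex of Z that misses it. The latter
   misses nothing else, so the charges are distinct and avoid [UZ]. *)
have cntY : #|Y :\: Y'| + #|UZ| <= #|Um|.
  pose g y := odflt y [pick z in Z | ~~ e z y].
  have gP y : y \in Y :\: Y' -> g y \in Z /\ ~~ e (g y) y.
    rewrite !inE => /andP[yY' yY]; rewrite /g; case: pickP => [z /andP[]//|no].
    case/negP: yY'; rewrite yY; apply/forallP=> z; apply/implyP=> zZ.
    by have := no z; rewrite zZ => /negbFE.
  have yU y : y \in Y :\: Y' -> y \in Z :|: Y by rewrite !inE => /andP[_ ->]; rewrite orbT.
  have yz y z : y \in Y :\: Y' -> z \in Z -> y != z.
    rewrite inE => /andP[_ yY] zZ; apply: contraTneq zZ => <-.
    by rewrite (disjointFl ZY yY).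
  rewrite -(card_in_imset (f := g) (D := mem (Y :\: Y'))); last first.
    move=> y y' yY yY' eg; have [gZ ge] := gP _ yY; have [_ ge'] := gP _ yY'.
    by apply: (one (g y)); rewrite ?yU ?yz // eg.
  rewrite addnC -cardsUI; set B := [set g x | x in _].
  have -> : #|UZ :&: B| = 0.
    apply/eqP; rewrite cards_eq0; apply/eqP/setP=> z; rewrite !inE; apply/negP.
    case/andP=> /andP[zZ /existsP[a /and3P[aZ az za]]] /imsetP[y yY ez].
    have [gZ ge] := gP _ yY; rewrite -ez in ge.
    have := one z a y zZ; rewrite in_setU aZ yU // => /(_ isT isT az).
    rewrite yz // => /(_ isT za ge) eay; have := yz y a yY aZ.
    by rewrite eay eqxx.
  rewrite addn0; apply: subset_leq_card; apply/subsetP=> z; rewrite inE => /orP[|/imsetP[y yY ->]].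
    rewrite !inE => /andP[-> /existsP[a /and3P[aZ az za]]] /=.
    by apply/existsP; exists a; rewrite !inE aZ az za.
  have [gZ ge] := gP _ yY; rewrite inE gZ; apply/existsP; exists y.
  by rewrite yU // yz // ge.
have cY : #|Y| = #|Y'| + #|Y :\: Y'|.
  by rewrite -(cardsID Y' Y); congr (_ + _); apply: eq_card => y; rewrite !inE andbA andbb.
have Y'Z z : z \in Z -> z \notin Y' by move/ZnY; apply: contra; apply: Y'Y.
pose K := Z :|: Y'.
have K8 : 8 <= #|K| by apply: leq_trans Z8 _; apply: subset_leq_card; apply: subsetUl.
exists K; split=> //.
  by apply/subsetP=> z; rewrite !inE => /orP[->//|/andP[->]]; rewrite orbT.
apply: hub_of_linkable => // L sL uL tK; rewrite set0U.
have LK p : p \in L -> p.1 \in K /\ p.2 \in K.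
  by move=> pL; rewrite !tK // ?term1 ?term2.
pose T := [set z in terms L].
have cT : #|T| = 8 by rewrite cardsE (card_uniqP uL) size_terms sL.
pose bb := [seq p <- L | ~~ e p.1 p.2 & p.1 \in Y'].
pose bz := [seq p <- L | ~~ e p.1 p.2 & p.1 \notin Y'].
have bbP p : p \in bb -> [/\ p \in L, p.1 \in Y' & p.2 \in Y'].
  rewrite mem_filter => /andP[/andP[h1 h2] pL]; split=> //.
  have [_] := LK _ pL; rewrite in_setU => /orP[pZ|//].
  by case/negP: h1; rewrite es; apply: Y'e.
have bzP p : p \in bz -> [/\ p \in L, p.1 \in Z, p.2 \in Z & ~~ e p.1 p.2].
  rewrite mem_filter => /andP[/andP[h1 h2] pL].
  have [] := LK _ pL; rewrite !in_setU (negPf h2) orbF => p1 /orP[pZ|p2]; first by split.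
  by case/negP: h1; apply: Y'e.
have cbb : 2 * size bb <= #|T :&: Y'|.
  rewrite -size_terms -(card_uniqP (terms_filter _ uL)); apply: subset_leq_card.
  apply/subsetP=> z /mem_terms[p /bbP[pL p1 p2] /orP[]/eqP->]; rewrite in_setI inE ?p1 ?p2.
    by rewrite term1.
  by rewrite term2.
have cbz : 2 * size bz <= #|UZ|.
  rewrite -size_terms -(card_uniqP (terms_filter _ uL)); apply: subset_leq_card.
  apply/subsetP=> z /mem_terms[p /bzP[pL p1 p2 h] /orP[]/eqP->]; rewrite !inE ?p1 ?p2 /=; apply/existsP.
    by exists p.2; rewrite p2 h eq_sym (terms_neq uL).
  by exists p.1; rewrite p1 es h (terms_neq uL).
have cTT : #|T :&: Z| + #|T :&: Y'| = 8.
  rewrite -cT -cardsUI -setIUr.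
  have -> : T :&: Z :&: (T :&: Y') = set0.
    apply/setP=> z; rewrite in_set0; apply/negP; rewrite !in_setI => /andP[/andP[_ /Y'Z h] /andP[_ h']].
    by rewrite h' in h.
  rewrite cards0 addn0; apply: eq_card => z; rewrite in_setI -/K.
  by have [|//] := boolP (z \in T); rewrite inE => /tK->.
have cZT : #|Z :\: T| = #|Z| - #|T :&: Z| by rewrite cardsD setIC.
have cYT : #|Y' :\: T| = #|Y'| - #|T :&: Y'| by rewrite cardsD setIC.
have le1 : #|T :&: Y'| <= #|Y'| by apply: subset_leq_card; apply: subsetIr.
(* Bad pairs and free vertices are matched by position. With Z first in [AL] and [bb] first in [BL],
   every bad pair inside [Y'] receives a vertex of Z. *)
pose AL := enum (Z :\: T) ++ enum (Y' :\: T).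
pose BL := bb ++ bz.
have sbb : size bb <= #|Z :\: T| by lia.
(* Twice the number of bad pairs is at most |[Y']| + |[UZ]| <= 2 (|Z| + |[Y']| - 8) + 1. Parity
   absorbs the last unit, so the constant 15 suffices in place of 16. *)
have sBL : size BL <= size AL.
  by rewrite !size_cat -!cardE; lia.
have uAL : uniq AL.
  rewrite cat_uniq !enum_uniq andbT /=; apply/hasPn=> z; rewrite !mem_enum !in_setD => /andP[_ zY].
  by apply/negP=> /andP[_ /Y'Z]; rewrite zY.
have ALP z : z \in AL -> z \in K /\ z \notin T.
  by rewrite mem_cat !mem_enum !in_setD in_setU => /orP[]/andP[-> ->]; rewrite ?orbT.
have BLP p : p \in L -> (p \in BL) = ~~ e p.1 p.2.
  by move=> pL; rewrite mem_cat !mem_filter pL !andbT; case: (e _ _) => //=; rewrite orbN.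
pose m p := nth p.1 AL (index p BL).
(* The only non-neighbour of x is x', so x sees every free vertex. *)
have half x x' a : x \in Z -> x' \in Z -> x \in T -> x' \in T -> x != x' -> ~~ e x x' ->
    a \in K -> a \notin T -> e x a.
  move=> xZ x'Z xT x'T xx' nxx' aK aT; apply: contraT => xa.
  suff ea : a = x' by rewrite ea x'T in aT.
  apply: (one x); rewrite ?in_setU ?x'Z //.
  - by move: aK; rewrite in_setU => /orP[->//|/Y'Y->]; rewrite orbT.
  - by apply: contraNneq aT => ->.
  - by rewrite eq_sym.
have mP p : p \in L -> ~~ e p.1 p.2 -> [/\ m p \in AL, e p.1 (m p) & e (m p) p.2].
  move=> pL np; have pB : p \in BL by rewrite BLP.
  have ip : index p BL < size AL by apply: leq_trans sBL; rewrite index_mem.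
  have mA : m p \in AL by apply: mem_nth.
  have [mK mT] := ALP _ mA.
  move: pB; rewrite mem_cat; case: (boolP (p \in bb)) => [pb _|_ /bzP[_ p1 p2 _]].
    have [_ p1 p2] := bbP _ pb.
    suff mZ : m p \in Z by rewrite es !Y'e.
    have ilt : index p bb < size bb by rewrite index_mem.
    rewrite /m /AL nth_cat -cardE index_cat pb (leq_trans ilt sbb).
    have : nth p.1 (enum (Z :\: T)) (index p bb) \in enum (Z :\: T).
      by apply: mem_nth; rewrite -cardE (leq_trans ilt sbb).
    by rewrite mem_enum in_setD => /andP[].
  have t1 : p.1 \in T by rewrite inE term1.
  have t2 : p.2 \in T by rewrite inE term2.
  have neq := terms_neq uL pL; split=> //; first exact: (half p.1 p.2).
  by rewrite es; apply: (half p.2 p.1) => //; rewrite 1?eq_sym // es.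
pose C p := if e p.1 p.2 then [set p.1; p.2] else [set p.1; p.2; m p].
exists C; split=> [p pL|p q pL qL pq].
  have [p1 p2] := LK _ pL; rewrite /C; case: ifP => [ep|/negbT np].
    by rewrite !inE !eqxx orbT subUset !sub1set p1 p2 connect_edge ?inE ?eqxx ?orbT.
  have [mA em1 em2] := mP _ pL np; have [mK _] := ALP _ mA.
  rewrite !inE !eqxx !orbT !subUset !sub1set p1 p2 mK; split=> //.
  by apply: (connect_trans (y := m p)); apply: connect_edge; rewrite ?inE ?eqxx ?orbT.
have Cz r z : r \in L -> z \in C r -> (z == r.1) || (z == r.2) || ((z == m r) && ~~ e r.1 r.2).
  by move=> _; rewrite /C; case: (e r.1 r.2); rewrite !inE ?andbT => // ->.
rewrite -setI_eq0; apply/eqP/setP=> z; rewrite in_setI in_set0; apply/negP=> /andP[].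
move=> /(Cz _ _ pL) h1 /(Cz _ _ qL) h2.
have tm r r' : r \in L -> r' \in L -> (z == r.1) || (z == r.2) -> (z == m r') && ~~ e r'.1 r'.2 -> False.
  move=> rL rL' h /andP[/eqP ez er']; have [mA _ _] := mP _ rL' er'.
  have [_ /negP] := ALP _ mA; apply; rewrite -ez inE; apply/mem_terms; by exists r.
case/orP: h1 => h1; case/orP: h2 => h2.
- by case/eqP: pq; apply: (terms_inj uL pL qL h1 h2).
- exact: (tm p q).
- exact: (tm q p).
case/andP: h1 => /eqP ez1 np; case/andP: h2 => /eqP ez2 nq.
have pB : p \in BL by rewrite BLP.
have qB : q \in BL by rewrite BLP.
have ip : index p BL < size AL by apply: leq_trans sBL; rewrite index_mem.
have iq : index q BL < size AL by apply: leq_trans sBL; rewrite index_mem.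
have : m p == m q by rewrite -ez1 -ez2.
rewrite /m (set_nth_default q.1 p.1 ip) nth_uniq // => /eqP /(congr1 (nth p BL)).
by rewrite !nth_index // => epq; rewrite epq eqxx in pq.
Qed.

End Pairs.

(** * Shortest paths *)

Section ShortWalks.
Variable V : finType.
Implicit Types (S T Q A U W X Y Z R D K H P : {set V}) (p : V * V) (q : seq V) (L : seq (V * V)).
Variable e : rel V.
Hypothesis es : symmetric e.

(** Only the inner vertices q have to lie in R; the ends s and t are terminals, outside R. *)
Definition walk R s t (q : seq V) := path e s (rcons q t) && all (mem R) q.
Definition walkset s t (q : seq V) : {set V} := [set x in s :: rcons q t].

Lemma path_restr S x (q : seq V) : x \in S -> {subset q <= S} -> path e x q ->
  connect (restr e S) x (last x q).
Proof.
elim: q x => [|y q IH] x xS qS /=; first by rewrite connect0.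
case/andP=> xy yq; have yS : y \in S by apply: qS; rewrite inE eqxx.
apply: connect_trans (IH y yS _ yq); first by apply: connect1; rewrite /restr xy xS yS.
by move=> z zq; apply: qS; rewrite inE zq orbT.
Qed.

Lemma walk_connect R s t q : walk R s t q -> connect (restr e (walkset s t q)) s t.
Proof.
case/andP=> pq _; rewrite -{2}(last_rcons s q t); apply: path_restr => //.
  by rewrite !inE eqxx.
by move=> z zq; rewrite inE inE zq orbT.
Qed.

Lemma not_walk_disconnected R s t a b : ~ (exists q, walk R s t q) -> a \in R -> e s a -> e b t ->
  ~~ connect (restr e R) a b.
Proof.
move=> no aR sa bt; apply/negP=> /connectP[q pq eb]; apply: no; exists (a :: q).
rewrite /walk /= sa aR rcons_path -eb bt andbT /=.
by elim: q a {sa aR eb} pq => //= c q IH a /andP[/and3P[-> _ ->] /IH].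
Qed.

Section Shortest.
Variables (R : {set V}) (s t : V) (q : seq V).
Hypotheses (wq : walk R s t q) (minq : forall q', walk R s t q' -> size q <= size q').
Let w := s :: rcons q t.

Let w_last_take i : i <= size q -> nth s w i = last s (take i q).
Proof.
case: i => [|i] iq; first by rewrite take0.
rewrite /w /= nth_rcons iq.
by rewrite (take_nth s iq) last_rcons.
Qed.

Let w_drop j : j <= size q -> rcons (drop j q) t = nth s w j.+1 :: drop j.+1 (rcons q t).
Proof.
move=> jq; rewrite /w /= -drop_nth ?size_rcons // -cats1 -cats1 drop_cat.
by case: ltngtP jq => // [->] _; rewrite drop_size subnn drop0.
Qed.

Let path_w : path e s (rcons q t).
Proof. by case/andP: wq. Qed.

Let path_take i : path e s (take i q).
Proof.
by move: path_w; rewrite -cats1 -{1}(cat_take_drop i q) -catA cat_path => /andP[].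
Qed.

Let path_drop j : j <= size q -> path e (nth s w j.+1) (drop j.+1 (rcons q t)).
Proof.
move=> jq; move: path_w; rewrite -{1}(cat_take_drop j (rcons q t)) cat_path => /andP[_].
by rewrite (drop_nth s) ?size_rcons //= => /andP[].
Qed.

Let allq : all (mem R) q.
Proof. by case/andP: wq. Qed.

Let all_take i : all (mem R) (take i q).
Proof. by move: allq; rewrite -{1}(cat_take_drop i q) all_cat => /andP[]. Qed.

Let all_drop i : all (mem R) (drop i q).
Proof. by move: allq; rewrite -{1}(cat_take_drop i q) all_cat => /andP[]. Qed.

(** A detour through z would replace the j - i - 1 vertices between the two seen ones by a single
    vertex. *)
Lemma window z i j : z \in R -> i <= j -> j <= (size q).+1 ->
  e z (nth s w i) -> e z (nth s w j) -> j <= i + 2.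
Proof.
move=> zR ij jq zi zj; case: j => [//|j] in ij jq zj *.
have [iq|iq] := leqP i (size q); last by lia.
have : walk R s t (take i q ++ z :: drop j q).
  rewrite /walk all_cat all_take /= all_drop zR !andbT rcons_cat cat_path path_take /=.
  by rewrite -w_last_take // es zi w_drop //= zj path_drop.
move/minq; rewrite size_cat /= size_drop size_take; case: ifP; lia.
Qed.

Lemma chord i j : i < j -> j <= (size q).+1 -> e (nth s w i) (nth s w j) -> j <= i.+1.
Proof.
move=> ij jq eij; case: j => [//|j] in ij jq eij *.
have iq : i <= size q by lia.
have : walk R s t (take i q ++ drop j q).
  rewrite /walk all_cat all_take /= all_drop andbT rcons_cat cat_path path_take /=.
  by rewrite -w_last_take // w_drop //= eij path_drop.
move/minq; rewrite size_cat /= size_drop size_take; case: ifP; lia.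
Qed.

Lemma walk_edge i : i <= size q -> e (nth s w i) (nth s w i.+1).
Proof. by move=> iq; apply: (pathP s path_w); rewrite size_rcons. Qed.

Lemma walk_interior i : 0 < i -> i <= size q -> nth s w i \in R.
Proof.
case: i => // i _ iq; rewrite /w /= nth_rcons iq.
by apply: (allP allq); apply: mem_nth.
Qed.

Lemma mem_walkset x : x \in walkset s t q -> exists2 i, i <= (size q).+1 & x = nth s w i.
Proof.
rewrite inE -/w => xw; exists (index x w); last by rewrite nth_index.
by have := xw; rewrite -index_mem /= size_rcons ltnS.
Qed.

Lemma sees_at_most3 z : z \in R -> #|[set x in walkset s t q | e z x]| <= 3.
Proof.
move=> zR; set i := find (e z) w.
apply: (@leq_trans #|[set nth s w i; nth s w i.+1; nth s w i.+2]|); last first.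
  apply: leq_trans (leq_card_setU _ _) _; rewrite cards1 cards2; by case: (_ != _).
apply: subset_leq_card; apply/subsetP=> x; rewrite inE => /andP[/mem_walkset[j jq ->] zj].
have ij : i <= j by rewrite leqNgt; apply/negP=> /(before_find s); rewrite zj.
have iw : has (e z) w.
  by apply/hasP; exists (nth s w j) => //; apply: mem_nth; rewrite /w /= size_rcons; lia.
have := window zR ij jq (nth_find s iw) zj => ji.
have : [|| j == i, j == i.+1 | j == i.+2] by lia.
by rewrite !inE -orbA => /or3P[]/eqP->; rewrite eqxx ?orbT.
Qed.

Hypotheses (sR : s \notin R) (tR : t \notin R) (st : s != t).

(** If a vertex recurs, the predecessor of its first occurrence is joined by a chord to the second;
    s has no predecessor, but recurs neither inside R nor as t. *)
Lemma walk_uniq : uniq w.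
Proof.
apply/(uniqP s) => i j; rewrite !inE /w /= size_rcons => iw jw.
wlog ij : i j iw jw / i < j => [h|].
  by case: (ltngtP i j) => // ij eij; [apply: h | apply/esym; apply: h].
case: i => [|i] in iw ij * => eij.
  have [jq|jq] := leqP j (size q).
    have e0 : s = nth s w j := eij.
    by move: sR; rewrite e0 walk_interior.
  have ej : j = (size q).+1 by lia.
  have e0 : s = nth s w j := eij.
  by move: st; rewrite {1}e0 ej /= nth_rcons ltnn !eqxx.
have := @chord i j; rewrite -/w in eij; rewrite -eij walk_edge; last by lia.
by move=> /(_ _ _ isT); lia.
Qed.

Lemma walkset_card : #|walkset s t q| = (size q).+2.
Proof. by rewrite cardsE (card_uniqP walk_uniq) /= size_rcons. Qed.

End Shortest.

(* a = number of vertices of a terminal pair or of a shortest path, o = how many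
   of them an outside vertex can see, k = size of the core, the part that a vertex
   seeing o of them sees entirely.  An unlinked pair has (2, 1, 0); on a shortest
   path the seen vertices lie among three consecutive ones, so that on a path with
   four vertices the two middle ones form the core. *)
Definition visibility (a o k : nat) :=
  (a = 2 /\ o = 1 /\ k = 0) \/ (a = 2 /\ o = 2 /\ k = 2) \/ (a = 3 /\ o = 3 /\ k = 3) \/
  (a = 4 /\ o = 3 /\ k = 2) \/ (5 <= a /\ o = 3 /\ k = 0).

Definition profile Q (o : nat) (core : {set V}) R := [/\ core \subset Q, visibility #|Q| o #|core| &
  forall z, z \in R -> #|[set x in core | ~~ e z x]| + #|[set x in Q | e z x]| <= o].

Lemma card_seen_unseen Q z : #|[set x in Q | ~~ e z x]| + #|[set x in Q | e z x]| = #|Q|.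
Proof.
rewrite addnC -(cardsID [set x | e z x] Q).
by congr (_ + _); apply: eq_card => x; rewrite !inE 1?andbC.
Qed.

Lemma walk_profile R s t q : walk R s t q ->
  (forall q', walk R s t q' -> size q <= size q') ->
  s \notin R -> t \notin R -> s != t ->
  exists o core, profile (walkset s t q) o core (R :\: walkset s t q).
Proof.
move=> wq minq sR tR st; have cP := walkset_card wq minq sR tR st.
set P := walkset s t q in cP *.
have [q1|q1] := leqP (size q) 1.
  exists #|P|, P; split=> //; first by rewrite /visibility; lia.
  by move=> z _; rewrite card_seen_unseen.
have [q2|q2] := leqP (size q) 2; last first.
  exists 3, set0; split; first exact: sub0set.
    by rewrite /visibility cards0; lia.
  move=> z; rewrite inE => /andP[_ zR].
  rewrite (_ : #|[set x in set0 | _]| = 0); first exact: (sees_at_most3 wq minq zR).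
  by apply/eqP; rewrite cards_eq0; apply/eqP/setP=> x; rewrite !inE.
have sz : size q = 2 by lia.
have uw := walk_uniq wq minq sR tR st.
have [a [b eq]] : exists a b, q = [:: a; b].
  by move: sz; case: (q) => [//|a [//|b [|//]]] _; exists a, b.
move: @P cP uw wq minq; rewrite {}eq => P cP uw wq minq.
have ab : a != b by move: uw; rewrite /= !inE !negb_or => /and4P[_ /andP[]].
exists 3, [set a; b]; split.
- by apply/subsetP=> x; rewrite !inE => /orP[]/eqP->; rewrite eqxx ?orbT.
- by rewrite -/P cP /visibility cards2 ab /=; lia.
move=> z; rewrite inE => /andP[_ zR].
(* A vertex that sees both ends would give a walk with one inner vertex. *)
have le1 : #|[set x in [set s; t] | e z x]| <= 1.
  apply/card_le1_eqP=> x y; rewrite !inE => /andP[/orP[]/eqP-> h1] /andP[/orP[]/eqP-> h2] //.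
    by have := window (i := 0) (j := 3) wq minq zR isT isT h1 h2.
  by have := window (i := 0) (j := 3) wq minq zR isT isT h2 h1.
have h : [set x in P | e z x] \subset [set x in [set a; b] | e z x] :|: [set x in [set s; t] | e z x].
  by apply/subsetP=> x; rewrite !inE /= => /andP[/or4P[]/eqP-> ->]; rewrite eqxx ?orbT.
have := leq_trans (subset_leq_card h) (leq_card_setU _ _).
have := card_seen_unseen [set a; b] z; rewrite cards2 ab.
move: #|_| #|_| #|_| #|_| le1 => *; lia.
Qed.

End ShortWalks.

(** * Dense neighbourhoods *)

Section Arithmetic.
Variables (n E r z q1 q2 o1 o2 k1 k2 : nat).
Hypotheses (ok1 : visibility q1 o1 k1) (ok2 : visibility q2 o2 k2).
Hypotheses (cn : n = r + 4 + q1 + q2) (n29 : n <= 29) (nE : n + E <= 30).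
Hypotheses (E1 : E != 1) (z2 : 2 * z <= r).

(** In use, n is the size of the neighbourhood, E the number of exceptional vertices, r the size of
    the remainder, z that of its smaller component, and m counts the non-neighbours of a vertex. The
    conclusion provides a vertex of the component that is not exceptional. *)
Lemma small_exceptional m : m + 15 <= z + 1 + o1 + o2 + 1 -> E < z.
Proof. by move: ok1 ok2; rewrite /visibility; lia. Qed.

(** At least 14 by the degree bound; at most 15 because 2z <= 25 - q1 - q2, while [visibility] gives
    2o - q <= 3 for both paths. *)
Lemma component_size m : m + 15 <= z + 1 + o1 + o2 ->
  z + o1 + o2 = 14 \/ z + o1 + o2 = 15.
Proof. by move: ok1 ok2; rewrite /visibility; lia. Qed.

(** This and the next two give the hypotheses of [near_complete], with Y made of v and the two
    cores. If the sum is 14, only exceptional vertices have a non-neighbour, whence u <= E; if it is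
    15, all z vertices may have one. *)
Lemma count14 u : z + o1 + o2 = 14 -> u <= E ->
  8 <= z /\ 15 + u <= 2 * z + (1 + k1 + k2).
Proof. by move: ok1 ok2; rewrite /visibility; lia. Qed.

Lemma count15 : z + o1 + o2 = 15 -> 8 <= z /\ 15 + z <= 2 * z + (1 + k1 + k2).
Proof. by move: ok1 ok2; rewrite /visibility; lia. Qed.

(** For the case that an exceptional vertex has to be left out of the component. A sum of 15 forces
    E <= 2, so there are exactly two. *)
Lemma count15_exceptional z' : z + o1 + o2 = 15 -> 0 < E -> z = z'.+1 ->
  [/\ 8 <= z', E = 2 & 15 + z' <= 2 * z' + (1 + k1 + k2)].
Proof. by move: ok1 ok2; rewrite /visibility => h1 h2 h3 h4 h5; split; lia. Qed.
End Arithmetic.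

Section Dense.
Variable V : finType.
Implicit Types (S T Q A U W X Y Z R D K P B : {set V}) (p : V * V) (q : seq V) (L : seq (V * V)).
Variable e : rel V.
Hypotheses (es : symmetric e) (ei : irreflexive e).

Definition deg_in h A := #|[set y in A | e h y]|.

Lemma deg_in_le h A : deg_in h A <= #|A|.
Proof. by apply: subset_leq_card; apply/subsetP=> y; rewrite inE => /andP[]. Qed.

Lemma deg_in_sub h A B : A \subset B -> deg_in h A <= deg_in h B.
Proof.
move=> /subsetP sAB; apply: subset_leq_card; apply/subsetP=> y.
by rewrite !inE => /andP[/sAB-> ->].
Qed.

Lemma deg_inU h A B : deg_in h (A :|: B) <= deg_in h A + deg_in h B.
Proof.
apply: leq_trans (leq_card_setU _ _); apply: subset_leq_card; apply/subsetP=> y.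
by rewrite !inE andb_orl.
Qed.

Lemma deg_in_split h A B : A \subset B -> deg_in h B = deg_in h A + deg_in h (B :\: A).
Proof.
move=> sAB; rewrite /deg_in -(cardsID A); congr (_ + _); apply: eq_card => y; rewrite !inE.
  by case: (boolP (y \in A)) => [/(subsetP sAB)->|]; rewrite ?andbT ?andbF.
by rewrite andbA.
Qed.

Lemma deg_in_terms h L : (forall p, p \in L -> ~~ (e h p.1 && e h p.2)) ->
  deg_in h [set x in terms L] <= size L.
Proof.
elim: L => [|p L IH] hL.
  by apply: leq_trans (deg_in_le _ _) _; rewrite cardsE (eq_card0 (A := mem [::])).
have h1 : deg_in h [set x in terms L] <= size L by apply: IH => p' p'L; apply: hL; rewrite inE p'L orbT.
have h2 : deg_in h [set p.1; p.2] <= 1.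
  have := hL p (mem_head _ _); rewrite /deg_in => np; apply/card_le1_eqP=> x y; rewrite !inE.
  case/andP=> [/orP[]/eqP-> hx] /andP[/orP[]/eqP-> hy] //; by rewrite hx hy in np.
have : [set x in terms (p :: L)] \subset [set p.1; p.2] :|: [set x in terms L].
  by apply/subsetP=> x; rewrite terms_cons !inE orbA.
move/(deg_in_sub h) => h3; have := deg_inU h [set p.1; p.2] [set x in terms L].
rewrite [size (p :: L)]/=; lia.
Qed.

Variables (v : V) (H E : {set V}).
Hypothesis vH : forall h, h \in H -> e v h.
Hypothesis H29 : #|H| <= 29.
Hypothesis HE30 : #|H| + #|E| <= 30.
Hypothesis E1 : #|E| != 1.
Hypothesis E2 : #|E| = 2 -> forall x y, x \in E -> y \in E -> x != y -> ~~ e x y.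
Hypothesis degH : forall h, h \in H -> 15 <= deg_in h H + (h \in E).

Definition has_hub := exists K, [/\ K \subset v |: H, 8 <= #|K| & hub e set0 K].

Let vnH : v \notin H.
Proof. by apply/negP=> /vH; rewrite ei. Qed.

(** One bound for two situations: without exceptions the degree is 15 among at most 29 vertices;
    otherwise there are at least two exceptions, and both numbers drop by one. *)
Lemma min_degree : exists d, [/\ 14 <= d <= 15, #|H| <= d + 14 &
  forall h, h \in H -> d <= deg_in h H].
Proof.
have [E0|En] := eqVneq #|E| 0.
  exists 15; split=> // h hH; have := degH hH.
  by rewrite (cards0_eq E0) inE; lia.
exists 14; split=> //; first by move: E1 En; lia.
by move=> h hH; have := degH hH; case: (h \in E); lia.
Qed.

(* The smaller component Z of the rest R of the neighbourhood misses at most one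
   vertex per vertex, up to exceptional vertices E, by counting degrees. *)
Lemma dense_component (R Z T1 T3 Q1 Q2 c1 c2 : {set V}) (o1 o2 : nat) :
  #|H| = #|R| + 4 + #|Q1| + #|Q2| -> H \subset R :|: T1 :|: T3 :|: Q1 :|: Q2 ->
  R \subset H -> Q1 \subset H -> Q2 \subset H ->
  [disjoint R & Q1] -> [disjoint R & Q2] -> [disjoint Q1 & Q2] ->
  profile e Q1 o1 c1 R -> profile e Q2 o2 c2 R ->
  (forall z, z \in R -> deg_in z T1 <= 1) -> (forall z, z \in R -> deg_in z T3 <= 1) ->
  Z \subset R -> Z != set0 -> (forall z y, z \in Z -> y \in R -> e z y -> y \in Z) ->
  2 * #|Z| <= #|R| -> has_hub.
Proof.
move=> cH sH RH Q1H Q2H dR1 dR2 dQ [c1Q ok1 p1] [c2Q ok2 p2] t1 t3 ZR Zn clZ Z2.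
pose Y := v |: (c1 :|: c2).
have zR z : z \in Z -> z \in R by apply: (subsetP ZR).
have zH z : z \in Z -> z \in H by move/zR; apply: (subsetP RH).
have vZ : v \notin Z by apply/negP=> /zH; rewrite (negPf vnH).
have c1n z : z \in R -> z \notin c1.
  by move=> h; apply/negP=> /(subsetP c1Q); rewrite (disjointFr dR1 h).
have c2n z : z \in R -> z \notin c2.
  by move=> h; apply/negP=> /(subsetP c2Q); rewrite (disjointFr dR2 h).
have cY : #|Y| = 1 + #|c1| + #|c2|.
  rewrite cardsU1 !inE negb_or.
  have -> : v \notin c1 by apply/negP=> /(subsetP c1Q)/(subsetP Q1H); rewrite (negPf vnH).
  have -> : v \notin c2 by apply/negP=> /(subsetP c2Q)/(subsetP Q2H); rewrite (negPf vnH).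
  rewrite cardsU; have -> : c1 :&: c2 = set0; last by rewrite cards0 subn0 addnA.
  apply/setP=> z; rewrite !inE; apply/negP=> /andP[/(subsetP c1Q) h /(subsetP c2Q)].
  by rewrite (disjointFr dQ h).
have YH : Y \subset v |: H.
  apply: setUS; rewrite subUset; apply/andP; split.
    exact: subset_trans c1Q Q1H.
  exact: subset_trans c2Q Q2H.
have ZY : [disjoint Z & Y].
  rewrite -setI_eq0; apply/eqP/setP=> z; rewrite in_setI in_set0; apply/negP=> /andP[zZ].
  rewrite in_setU1 in_setU (negPf (c1n _ (zR _ zZ))) (negPf (c2n _ (zR _ zZ))) !orbF.
  by move=> /eqP ez; rewrite ez (negPf vZ) in zZ.
pose miss z := [set a in Z :|: Y | (a != z) && ~~ e z a].
(* Non-neighbours and neighbours together: |Z| - 1 inside Z, at most one neighbour in each unlinked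
   pair, and [o1] and [o2] by the two profiles. The vertex v is never missed. *)
have cmiss z : z \in Z -> #|miss z| + deg_in z H <= #|Z| + 1 + o1 + o2.
  move=> zZ; have zRz := zR _ zZ.
  have d1 : deg_in z H <= deg_in z R + deg_in z T1 + deg_in z T3 + deg_in z Q1 + deg_in z Q2.
    apply: leq_trans (deg_in_sub z sH) _; do 3!(apply: leq_trans (deg_inU _ _ _) _; rewrite leq_add2r).
    exact: deg_inU.
  have d2 : deg_in z R <= deg_in z Z.
    apply: subset_leq_card; apply/subsetP=> y; rewrite !inE => /andP[yR zy].
    by rewrite zy (clZ z).
  have m1 : miss z \subset ([set x in Z :\ z | ~~ e z x] :|: [set x in c1 | ~~ e z x]) :|: [set x in c2 | ~~ e z x].
    apply/subsetP=> a; rewrite !inE => /and3P[h az za]; rewrite za az !andbT /=.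
    case/orP: h => [->//|/or3P[/eqP ea|->|->]]; rewrite ?orbT //.
    by rewrite ea es vH ?zH in za.
  have s1 : #|[set x in Z :\ z | ~~ e z x]| + deg_in z Z = #|Z| - 1.
    rewrite [#|Z|](cardsD1 z) zZ add1n subn1 /= -(card_seen_unseen e (Z :\ z) z); congr (_ + _).
    apply: eq_card => x; rewrite !inE; case: (eqVneq x z) => [->|//].
    by rewrite ei andbF.
  have Z0 : 0 < #|Z| by rewrite card_gt0.
  have b1 := p1 z zRz; have b2 := p2 z zRz; have b3 := t1 z zRz; have b4 := t3 z zRz.
  have b5 : #|miss z| <= #|[set x in Z :\ z | ~~ e z x]| + #|[set x in c1 | ~~ e z x]| + #|[set x in c2 | ~~ e z x]|.
    apply: leq_trans (subset_leq_card m1) _; apply: leq_trans (leq_card_setU _ _) _.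
    by rewrite leq_add2r; apply: (leq_card_setU _ _).
  rewrite -!/(deg_in _ _) in b1 b2; move: b1 b2 b3 b4 b5 s1 Z0 d1 d2; clear.
  move: (deg_in z H) (deg_in z R) (deg_in z T1) (deg_in z T3) (deg_in z Q1) (deg_in z Q2) (deg_in z Z) #|miss z| #|Z|.
  move: #|[set x in Z :\ z | _]| #|[set x in c1 | _]| #|[set x in c2 | _]|; lia.
have cmissE z : z \in Z -> #|miss z| + 15 <= #|Z| + 1 + o1 + o2 + (z \in E).
  by move=> zZ; move: (cmiss z zZ) (degH (zH _ zZ)); clear; lia.
have sub (Z' : {set V}) : Z' \subset Z -> 8 <= #|Z'| ->
    (forall z, z \in Z' -> #|[set a in Z' :|: Y | (a != z) && ~~ e z a]| <= 1) ->
    15 + #|[set z in Z' | [exists a in Z' :|: Y, (a != z) && ~~ e z a]]| <= 2 * #|Z'| + #|Y| -> has_hub.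
  move=> sZ' Z8 m1 cnt.
  have dZ' : [disjoint Z' & Y] by apply: disjointWl ZY.
  have [K [KZ K8 hK]] := near_complete es dZ' Z8 m1 cnt.
  exists K; split=> //; apply: subset_trans KZ _; rewrite subUset YH andbT.
  by apply: subset_trans sZ' _; apply: subset_trans ZR _; apply: subset_trans RH (subsetUr _ _).
have [x0 x0Z x0E] : exists2 z, z \in Z & z \notin E.
  apply/subsetPn/negP=> /subset_leq_card; rewrite leqNgt => /negP; apply.
  case/set0Pn: Zn => z zZ; apply: (small_exceptional ok1 ok2 cH H29 HE30 E1 Z2 (m := #|miss z|)).
  by apply: leq_trans (cmissE z zZ) _; rewrite leq_add2l leq_b1.
have x0m := cmissE _ x0Z; rewrite (negPf x0E) addn0 in x0m.
(* If the sum is 14, a vertex outside E misses nothing and one in E at most one vertex; if it is 15,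
   one and two respectively. *)
have [k14|k15] := component_size ok1 ok2 cH H29 HE30 E1 Z2 x0m.
- have uE : #|[set z in Z | [exists a in Z :|: Y, (a != z) && ~~ e z a]]| <= #|E|.
    apply: subset_leq_card; apply/subsetP=> z; rewrite inE => /andP[zZ /existsP[a ha]].
    have : 0 < #|miss z| by rewrite card_gt0; apply/set0Pn; exists a; rewrite inE.
    by move: (cmissE z zZ) k14; case: (z \in E) => //; clear; lia.
  have [Z8 cnt] := count14 ok1 ok2 cH H29 HE30 E1 Z2 k14 uE.
  apply: (sub Z) => //; last by rewrite cY.
  move=> z zZ; rewrite -/(miss z); move: (cmissE z zZ) k14 (leq_b1 (z \in E)).
  clear; lia.
have [/existsP[x /andP[xE xZ]]|/existsPn no] := boolP [exists x in E, x \in Z]; last first.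
  have [Z8 cnt] := count15 ok1 ok2 cH H29 HE30 E1 Z2 k15.
  apply: (sub Z) => //.
    move=> z zZ; rewrite -/(miss z); have := no z; rewrite zZ andbT => /negPf zE.
    by move: (cmissE z zZ) k15; rewrite zE; clear; lia.
  rewrite cY; apply: leq_trans cnt; rewrite leq_add2l.
  by apply: subset_leq_card; apply/subsetP=> z; rewrite inE => /andP[].
have E0 : 0 < #|E| by rewrite card_gt0; apply/set0Pn; exists x.
(* The two exceptional vertices are not adjacent, so leaving out x also removes one of the at most
   two vertices that the other one misses. *)
have cZ : #|Z| = #|Z :\ x|.+1 by rewrite [LHS](cardsD1 x) xZ.
have [Z8 Eq2 cnt] := count15_exceptional ok1 ok2 cH H29 HE30 E1 Z2 k15 E0 cZ.
apply: (sub (Z :\ x)) => //.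
- exact: subsetDl.
- move=> z; rewrite in_setD1 => /andP[zx zZ].
  have := cmissE z zZ; case: (boolP (z \in E)) => zE.
    have zxe := E2 Eq2 zE xE zx.
    have : x \in miss z by rewrite !inE xZ [x == z]eq_sym zx zxe.
    rewrite (cardsD1 x (miss z)) => -> h.
    apply: (@leq_trans #|miss z :\ x|); last by move: h k15; clear; lia.
    apply: subset_leq_card; apply/subsetP=> a; rewrite [a \in _ :\ _]in_setD1 [a \in miss z]inE.
    rewrite inE in_setU [a \in Z :|: Y]in_setU in_setD1 => /andP[/orP[/andP[-> ->]|aY] ->] //=.
    by rewrite aY orbT !andbT; apply/eqP=> ea; have := disjointFr ZY xZ; rewrite -ea aY.
  move=> h; apply: (@leq_trans #|miss z|); last by move: h k15; clear; lia.
  apply: subset_leq_card; apply/subsetP=> a; rewrite [a \in miss z]inE.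
  by rewrite inE in_setU [a \in Z :|: Y]in_setU in_setD1 => /andP[/orP[/andP[_ ->]|->] ->]; rewrite ?orbT.
rewrite cY; apply: leq_trans cnt; rewrite leq_add2l.
by apply: subset_leq_card; apply/subsetP=> z; rewrite inE => /andP[].
Qed.

Lemma not_both R z p : z \in R -> ~ (exists q, walk e R p.1 p.2 q) ->
  ~~ (e z p.1 && e z p.2).
Proof.
move=> zR no; apply/negP=> /andP[h1 h2]; apply: no; exists [:: z].
by rewrite /walk /= zR (es p.1) h1 h2.
Qed.

Lemma see_pair R z p : z \in R -> ~ (exists q, walk e R p.1 p.2 q) ->
  deg_in z [set p.1; p.2] <= 1.
Proof.
move=> zR no; have := @deg_in_terms z [:: p]; rewrite /terms /=.
have -> : [set x in [:: p.1; p.2]] = [set p.1; p.2] by apply/setP=> x; rewrite !inE.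
by apply=> p'; rewrite inE => /eqP->; apply: not_both no.
Qed.

(** Both ends of the first pair have neighbours in R, since their at least 14 neighbours do not fit
    into the 11 + 2 other vertices. These neighbours lie in different components of R, one of which
    holds at most half of it. *)
Lemma separated (R Q1 Q2 c1 c2 : {set V}) (o1 o2 : nat) (u1 u2 : V * V) :
  #|H| = #|R| + 4 + #|Q1| + #|Q2| ->
  H \subset R :|: [set u1.1; u1.2] :|: [set u2.1; u2.2] :|: Q1 :|: Q2 ->
  R \subset H -> Q1 \subset H -> Q2 \subset H ->
  [disjoint R & Q1] -> [disjoint R & Q2] -> [disjoint Q1 & Q2] ->
  profile e Q1 o1 c1 R -> profile e Q2 o2 c2 R ->
  u1.1 \in H -> u1.2 \in H -> #|Q1| + #|Q2| <= 11 ->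
  ~ (exists q, walk e R u1.1 u1.2 q) -> ~ (exists q, walk e R u2.1 u2.2 q) -> has_hub.
Proof.
move=> cH sH RH Q1H Q2H d1 d2 dQ p1 p2 sh th cQ no1 no2.
have nst : ~~ e u1.1 u1.2.
  by apply/negP=> h; apply: no1; exists [::]; rewrite /walk /= h.
have [d [/andP[d14 _] _ dH]] := min_degree.
have nbr x : x \in H -> (x == u1.1) || (x == u1.2) -> exists2 a, a \in R & e x a.
  move=> xH xu; have : 0 < deg_in x R.
    have t0 : deg_in x [set u1.1; u1.2] = 0.
      apply/eqP; rewrite cards_eq0; apply/eqP/setP=> y; rewrite !inE; apply/negP.
      by case/andP=> /orP[]/eqP->; case/orP: xu => /eqP->; rewrite ?ei 1?es ?(negPf nst) // es (negPf nst).
    have := dH _ xH; have := deg_in_sub x sH.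
    have := deg_inU x (R :|: [set u1.1; u1.2] :|: [set u2.1; u2.2] :|: Q1) Q2.
    have := deg_inU x (R :|: [set u1.1; u1.2] :|: [set u2.1; u2.2]) Q1.
    have := deg_inU x (R :|: [set u1.1; u1.2]) [set u2.1; u2.2].
    have := deg_inU x R [set u1.1; u1.2].
    have := deg_in_le x Q1; have := deg_in_le x Q2; have := deg_in_le x [set u2.1; u2.2].
    have : #|[set u2.1; u2.2]| <= 2 by rewrite cards2; case: (_ != _).
    rewrite t0; move: d14 cQ; clear; lia.
  by rewrite card_gt0 => /set0Pn[a]; rewrite inE => /andP[aR xa]; exists a.
have [a aR sa] := nbr _ sh (introT orP (or_introl (eqxx _))).
have [b bR tb] := nbr _ th (introT orP (or_intror (eqxx _))).
have nab : ~~ connect (restr e R) a b by apply: (not_walk_disconnected no1) => //; rewrite es.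
pose C x := [set z in R | connect (restr e R) x z].
have rs : connect_sym (restr e R) by apply: connect_sym_of; apply: restr_sym.
have Cne x : x \in R -> C x != set0.
  by move=> xR; apply/set0Pn; exists x; rewrite inE xR connect0.
have Cs x : C x \subset R by apply/subsetP=> z; rewrite inE => /andP[].
have Ccl x z y : z \in C x -> y \in R -> e z y -> y \in C x.
  rewrite !inE => /andP[zR xz] yR zy; rewrite yR; apply: connect_trans xz _.
  by apply: connect1; rewrite /restr zy zR yR.
have Cd : #|C a| + #|C b| <= #|R|.
  rewrite -cardsUI; have -> : C a :&: C b = set0.
    apply/setP=> z; rewrite !inE; apply/negP=> /andP[/andP[_ az] /andP[_ bz]].
    by case/negP: nab; apply: connect_trans az _; rewrite rs.
  by rewrite cards0 addn0; apply: subset_leq_card; rewrite subUset !Cs.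
have main x : x \in R -> 2 * #|C x| <= #|R| -> has_hub.
  move=> xR x2; apply: (@dense_component R (C x) [set u1.1; u1.2] [set u2.1; u2.2] Q1 Q2 c1 c2 o1 o2) => //.
  - by move=> z zR; apply: see_pair no1.
  - by move=> z zR; apply: see_pair no2.
  - exact: Cne.
  - exact: Ccl.
have [le|le] := leqP #|C a| #|C b|; [apply: (main a)|apply: (main b)] => //; move: le Cd; clear; lia.
Qed.

Lemma residual U L p R q P : uniq (terms L) -> {subset terms L <= U} -> p \in L ->
  R = U :\: [set x in terms L] -> P = walkset p.1 p.2 q -> walk e R p.1 p.2 q ->
  [/\ P \subset U, {subset terms (rem p L) <= U :\: P} &
    R :\: P = (U :\: P) :\: [set x in terms (rem p L)]].
Proof.
move=> uL tL pL eR eP /andP[_ /allP allq].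
have PE x : x \in P -> (x == p.1) || (x == p.2) \/ x \in R.
  rewrite eP !inE mem_rcons inE => /or3P[->|->|/allq h]; rewrite ?orbT; by [left|left|right].
have tpe : perm_eq (terms L) (terms (p :: rem p L)) by apply/terms_perm/perm_to_rem.
have tm x : (x \in terms L) = [|| x == p.1, x == p.2 | x \in terms (rem p L)].
  by rewrite (perm_mem tpe) terms_cons !inE.
have : uniq (terms (p :: rem p L)) by rewrite -(perm_uniq tpe).
rewrite terms_cons /= inE negb_or => /and3P[/andP[_ p1n] p2n _].
have RnT x : x \in R -> x \notin terms L by rewrite eR !inE => /andP[].
have p1P : p.1 \in P by rewrite eP !inE eqxx.
have p2P : p.2 \in P by rewrite eP !inE mem_rcons inE eqxx orbT.
split.
- apply/subsetP=> x /PE[h|]; last by rewrite eR !inE => /andP[].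
  by apply: tL; rewrite tm orbA h.
- move=> x xt; rewrite inE tL ?tm ?xt ?orbT // andbT; apply/negP=> /PE[|/RnT].
    by case/orP=> /eqP ex; move: p1n p2n; rewrite -ex xt.
  by rewrite tm xt !orbT.
- apply/setP=> x; rewrite eR !inE tm.
  have [_|xP] := boolP (x \in P); rewrite /= ?andbF //.
  have -> : (x == p.1) = false by apply: contraNF xP => /eqP->.
  by have -> : (x == p.2) = false by apply: contraNF xP => /eqP->.
Qed.

Lemma linkable_nil A : linkable e A [::].
Proof. by exists (fun=> set0); split. Qed.

Lemma linkable_cons A P L p : P \subset A -> p.1 \in P -> p.2 \in P -> p \notin L ->
  connect (restr e P) p.1 p.2 -> linkable e (A :\: P) L -> linkable e A (p :: L).
Proof.
move=> PA p1 p2 pL cp [C [hC dC]].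
have nep p' : p' \in L -> p' == p = false by move=> p'L; apply: contraNF pL => /eqP<-.
have dP p' : p' \in L -> [disjoint P & C p'].
  move=> p'L; have [s _ _ _] := hC _ p'L; rewrite disjoint_sym; apply: disjointWl s _.
  by rewrite disjoint_sym disjoints_subset setCD subsetUr.
exists (fun p' => if p' == p then P else C p'); split.
  move=> p'; rewrite inE; case: eqP => [->//|_] /= /hC[h1 h2 h3 h4]; split=> //.
  exact: subset_trans h1 (subsetDl _ _).
move=> p' p''; rewrite !inE; case: (eqVneq p' p) => [->|n1] /=; case: (eqVneq p'' p) => [->|n2] //=.
- by move=> _ h _; apply: dP.
- by move=> h _ _; rewrite disjoint_sym; apply: dP.
- exact: dC.
Qed.

Lemma linkable_perm A L L' : perm_eq L L' -> linkable e A L -> linkable e A L'.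
Proof.
move=> h [C [h1 h2]]; exists C; split=> [p|p p']; rewrite -!(perm_mem h); [exact: h1|exact: h2].
Qed.

(** Otherwise each vertex of R sees at most one end of each pair, hence at least d - 4 vertices of
    R. Neighbours of the two ends of a pair then have disjoint closed neighbourhoods in R, so 2 (d -
    3) <= |H| - 8 <= d + 6, against d >= 14. *)
Lemma short_walk L : size L = 4 -> uniq (terms L) -> {subset terms L <= H} ->
  exists p q, [/\ p \in L, walk e (H :\: [set x in terms L]) p.1 p.2 q & size q <= 3].
Proof.
move=> sL uL tL; set T := [set x in terms L]; set R := H :\: T.
have cT : #|T| = 8 by rewrite cardsE (card_uniqP uL) size_terms sL.
have TH : T \subset H by apply/subsetP=> x; rewrite inE; apply: tL.
have cR : #|R| = #|H| - 8 by rewrite cardsD (setIidPr TH) cT.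
apply: NNPP => no.
have no1 p q : p \in L -> walk e R p.1 p.2 q -> 3 < size q.
  by move=> pL w; rewrite ltnNge; apply/negP=> h; apply: no; exists p, q.
have [d [/andP[d14 d15] Hd dH]] := min_degree.
have RH : R \subset H by apply: subsetDl.
have HRT h : deg_in h H = deg_in h T + deg_in h R by apply: deg_in_split.
have nbr x : x \in H -> exists2 a, a \in R & e x a.
  move=> xH; have : 0 < deg_in x R by move: (dH _ xH) (deg_in_le x T) d14; rewrite HRT cT; clear; lia.
  by rewrite card_gt0 => /set0Pn[a]; rewrite inE => /andP[aR xa]; exists a.
have big z : z \in R -> d - 3 <= #|z |: [set y in R | e z y]|.
  move=> zR; rewrite cardsU1 inE ei andbF /= add1n.
  have : deg_in z T <= 4.
    rewrite -sL; apply: deg_in_terms => p pL; apply/negP=> /andP[h1 h2].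
    by have := no1 p [:: z] pL; rewrite /walk /= zR (es p.1) h1 h2 => /(_ isT).
  by move: (dH _ (subsetP RH _ zR)); rewrite HRT -/(deg_in z R); clear; lia.
case: L sL uL tL @T @R cT TH cR no no1 RH HRT nbr big => [//|p L] sL uL tL T R cT TH cR no no1 RH HRT nbr big.
have [|a aR sa] := nbr p.1; first by apply: tL; rewrite terms_cons inE eqxx.
have [|b bR tb] := nbr p.2; first by apply: tL; rewrite terms_cons !inE eqxx orbT.
set A := a |: [set y in R | e a y]; set B := b |: [set y in R | e b y].
have AB : A :&: B = set0.
  apply/setP=> c; rewrite !inE; apply/negP=> /andP[hA hB].
  have pL : p \in p :: L by rewrite mem_head.
  have bt : e b p.2 by rewrite es.
  case/orP: hA => [/eqP ca|/andP[cR' ac]]; case/orP: hB => [/eqP cb|/andP[cR'' bc]].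
  - have at2 : e a p.2 by rewrite -ca cb.
    by have := no1 p [:: a] pL; rewrite /walk /= aR sa at2 => /(_ isT).
  - have ab : e a b by rewrite es -ca.
    by have := no1 p [:: a; b] pL; rewrite /walk /= aR bR sa bt ab => /(_ isT).
  - have ab : e a b by rewrite -cb.
    by have := no1 p [:: a; b] pL; rewrite /walk /= aR bR sa bt ab => /(_ isT).
  - have cb : e c b by rewrite es.
    have cRR : c \in R by rewrite !inE.
    by have := no1 p [:: a; c; b] pL; rewrite /walk /= aR bR cRR sa bt ac cb => /(_ isT).
have : #|A| + #|B| <= #|R|.
  rewrite -cardsUI AB cards0 addn0; apply: subset_leq_card.
  by rewrite !subUset !sub1set aR bR; apply/andP; split; apply/subsetP=> x; rewrite inE => /andP[].
by move: (big _ aR) (big _ bR) d14 d15 Hd cR; rewrite -/A -/B; clear; lia.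
Qed.

(** The minimum is taken over all pairs at once, which also limits what a vertex of R can see of the
    other pairs. *)
Lemma shortest_pair R L : (exists p q, p \in L /\ walk e R p.1 p.2 q) ->
  exists p q, [/\ p \in L, walk e R p.1 p.2 q &
    forall p' q', p' \in L -> walk e R p'.1 p'.2 q' -> size q <= size q'].
Proof.
move=> [p [q [pL w]]].
pose P (x : (V * V) * seq V) := x.1 \in L /\ walk e R x.1.1 x.1.2 x.2.
have [[p' q'] [[/= pL' w'] min]] := @exists_minimum _ P (fun x => size x.2) (ex_intro _ (p, q) (conj pL w)).
by exists p', q'; split=> // p2 q2 h1 h2; apply: (min (p2, q2)).
Qed.

(** A longer path would have three disjoint neighbourhoods in R, at its ends and at a vertex in
    between: 2 (d - 4 - |P|) + (d - 5) <= |H| - |P| - 6. This fails for |P| <= 5, |H| <= d + 14 and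
    d >= 14. *)
Lemma second_walk P L p q : size L = 3 -> uniq (terms L) -> {subset terms L <= H :\: P} ->
  P \subset H -> #|P| <= 5 ->
  let R := (H :\: P) :\: [set x in terms L] in
  (forall z, z \in R -> deg_in z P <= 3) ->
  p \in L -> walk e R p.1 p.2 q ->
  (forall p' q', p' \in L -> walk e R p'.1 p'.2 q' -> size q <= size q') ->
  size q <= 4.
Proof.
move=> sL uL tL PH P5 R dP pL wq min; set T := [set x in terms L] in R wq min dP *.
rewrite leqNgt; apply/negP=> q5.
have minp q' : walk e R p.1 p.2 q' -> size q <= size q' by apply: min.
have cT : #|T| = 6 by rewrite cardsE (card_uniqP uL) size_terms sL.
have TH : T \subset H :\: P by apply/subsetP=> x; rewrite inE; apply: tL.
have RHP : R \subset H :\: P by apply: subsetDl.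
have RH : R \subset H by apply: subset_trans RHP (subsetDl _ _).
have cHP : #|H :\: P| = #|H| - #|P| by rewrite cardsD (setIidPr PH).
have cR : #|R| = #|H| - #|P| - 6 by rewrite cardsD (setIidPr TH) cT cHP.
have dgH h : deg_in h H = deg_in h P + (deg_in h T + deg_in h R).
  by rewrite (deg_in_split h PH) (deg_in_split h TH).
have [d [/andP[d14 d15] Hd dH]] := min_degree.
have tHp x : (x == p.1) || (x == p.2) -> x \in T.
  by move=> h; rewrite inE; apply/mem_terms; exists p.
have nst : ~~ e p.1 p.2.
  by apply/negP=> h; move: (minp [::]); rewrite /walk /= h => /(_ isT); move: q5; clear; lia.
have nst' : ~~ e p.2 p.1 by rewrite es.
have npp := terms_neq uL pL.
have endd x : (x == p.1) || (x == p.2) -> d - 4 - #|P| <= deg_in x R.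
  move=> hx; have xH : x \in H by have := subsetP TH _ (tHp _ hx); rewrite inE => /andP[].
  have : deg_in x T <= 4.
    have -> : deg_in x T = deg_in x (T :\: [set p.1; p.2]).
      apply: eq_card => y; rewrite !inE; have [/orP hy|//] := boolP ((y == p.1) || (y == p.2)).
      rewrite /=; apply: negbTE; rewrite negb_and orbC.
      by case: hy => /eqP->; case/orP: hx => /eqP->; rewrite ?ei ?nst ?nst'.
    apply: leq_trans (deg_in_le _ _) _; rewrite cardsD (setIidPr _); first by rewrite cT cards2 npp.
    by apply/subsetP=> y; rewrite in_set2; apply: tHp.
  by move: (dH _ xH) (deg_in_le x P); rewrite dgH; clear; lia.
have seeT z : z \in R -> deg_in z T <= 3.
  move=> zR; rewrite -sL; apply: deg_in_terms => p' p'L; apply/negP=> /andP[h1 h2].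
  by have := min p' [:: z] p'L; rewrite /walk /= zR (es p'.1) h1 h2 => /(_ isT); move: q5; clear; lia.
set w := p.1 :: rcons q p.2.
have w0 : nth p.1 w 0 = p.1 by [].
have wt : nth p.1 w (size q).+1 = p.2 by rewrite /w /= nth_rcons ltnn eqxx.
(* With at least five inner vertices, position 3 is at least three steps from both ends, so [window]
   and [chord] keep the neighbourhoods apart. *)
set z3 := nth p.1 w 3.
have z3R : z3 \in R by apply: (walk_interior wq) => //; move: q5; clear; lia.
pose N x := [set y in R | e x y].
have q3 : 3 <= (size q).+1 by move: q5; clear; lia.
have far z : z \in R -> ~~ ((e z p.1 && e z z3) || (e z p.1 && e z p.2) || (e z z3 && e z p.2)).
  move=> zR; apply/negP=> /orP[/orP[]|] /andP[].
  - rewrite -w0 => h1 h2; by have := window es wq minp zR (isT : 0 <= 3) q3 h1 h2.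
  - rewrite -w0 -wt => h1 h2; have := window es wq minp zR (leq0n _) (leqnn _) h1 h2; move: q5; clear; lia.
  - rewrite -wt => h1 h2; have := window es wq minp zR q3 (leqnn _) h1 h2; move: q5; clear; lia.
have n1 : ~~ e p.1 z3.
  apply/negP; rewrite -w0 => h; by have := chord wq minp (isT : 0 < 3) q3 h.
have n2 : ~~ e z3 p.2.
  apply/negP; rewrite -wt => h; have h3 : 3 < (size q).+1 by move: q5; clear; lia.
  have := chord wq minp h3 (leqnn _) h; move: q5; clear; lia.
have c3 : #|z3 |: N z3| = (deg_in z3 R).+1 by rewrite cardsU1 inE ei andbF.
have cs : #|N p.1| = deg_in p.1 R by [].
have ct : #|N p.2| = deg_in p.2 R by [].
have NP x z : z \in N x -> z \in R /\ e x z by rewrite inE => /andP[].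
have D1 : N p.1 :&: (z3 |: N z3) = set0.
  apply/setP=> z; rewrite in_setI in_setU1 in_set0; apply/negP=> /andP[/NP[zR h1]].
  case/orP=> [/eqP e1|/NP[_ h2]]; first by move: n1; rewrite -e1 h1.
  by have := far z zR; rewrite (es z p.1) h1 (es z z3) h2.
have D2 : (N p.1 :|: (z3 |: N z3)) :&: N p.2 = set0.
  apply/setP=> z; rewrite in_setI in_setU in_setU1 in_set0; apply/negP=> /andP[h /NP[zR h2]].
  have h2' : e z p.2 by rewrite es.
  case/or3P: h => [/NP[_ h1]|/eqP e1|/NP[_ h1]].
  - by have := far z zR; rewrite (es z p.1) h1 h2' orbT.
  - by move: n2; rewrite -e1 h2'.
  - by have := far z zR; rewrite (es z z3) h1 h2' !orbT.
have : #|N p.1| + #|z3 |: N z3| + #|N p.2| <= #|R|.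
  rewrite -(cardsUI (N p.1)) D1 cards0 addn0 -cardsUI D2 cards0 addn0.
  apply: subset_leq_card; rewrite !subUset sub1set z3R.
  by do !(apply/andP; split=> //); apply/subsetP=> z; rewrite inE => /andP[].
rewrite c3 cs ct.
have := endd p.1; rewrite eqxx => /(_ isT); have := endd p.2; rewrite eqxx orbT => /(_ isT).
have := dH _ (subsetP RH _ z3R); rewrite dgH; have := seeT _ z3R; have := dP _ z3R.
by move: d14 Hd cR P5; clear; lia.
Qed.

Lemma profile_sub Q o (c R R' : {set V}) : R' \subset R -> profile e Q o c R -> profile e Q o c R'.
Proof. by move=> /subsetP sR [h1 h2 h3]; split=> // z /sR; apply: h3. Qed.

Lemma profile_see Q o (c R : {set V}) z : profile e Q o c R -> z \in R -> deg_in z Q <= 3.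
Proof.
move=> [_ ok h3] /h3; rewrite -/(deg_in z Q).
have : o <= 3 by move: ok; rewrite /visibility; clear; lia.
by clear; lia.
Qed.

Lemma term_not_in U L p : p \in L ->
  (p.1 \notin U :\: [set x in terms L]) /\ (p.2 \notin U :\: [set x in terms L]).
Proof. by move=> pL; rewrite !inE term1 // term2. Qed.

Lemma walkset_start s t q : s \in walkset s t q.
Proof. by rewrite !inE eqxx. Qed.

Lemma walkset_end s t q : t \in walkset s t q.
Proof. by rewrite !inE mem_rcons inE eqxx orbT. Qed.

(** Two successive shortest paths have at most 5 and 6 vertices, whence the 11 in [separated]. If
    there is no second path, a third unlinked pair takes its place, with visibility (2, 1, 0). The
    third path need not be short, as the last pair is joined through v. *)
Lemma dense_neighbourhood L : size L = 4 -> uniq (terms L) -> {subset terms L <= H} ->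
  linkable e (v |: H) L \/ has_hub.
Proof.
move=> sL uL tL; set R0 := H :\: [set x in terms L].
have [p0 [q0 [p0L w0 q03]]] := short_walk sL uL tL.
have [p1 [q1 [p1L w1 min1]]] := @shortest_pair R0 L (ex_intro _ p0 (ex_intro _ q0 (conj p0L w0))).
have q13 : size q1 <= 3 by apply: leq_trans (min1 _ _ p0L w0) q03.
have min1' q' : walk e R0 p1.1 p1.2 q' -> size q1 <= size q' by apply: min1.
have [a1 a2] := term_not_in H p1L; have np1 := terms_neq uL p1L.
set P1 := walkset p1.1 p1.2 q1.
have cP1 : #|P1| = (size q1).+2 by apply: walkset_card w1 min1' a1 a2 np1.
have [o1 [c1 prof1]] := walk_profile es w1 min1' a1 a2 np1.
have [P1H tL1 eR1] := residual uL tL p1L erefl erefl w1.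
rewrite -/P1 in prof1 P1H tL1 eR1.
have pe1 := perm_to_rem p1L; set L1 := rem p1 L in tL1 eR1 pe1.
have sL1 : size L1 = 3 by have := perm_size pe1; rewrite sL /= => -[].
have uL1' : uniq (terms (p1 :: L1)) by rewrite -(perm_uniq (terms_perm pe1)).
have uL1 : uniq (terms L1) by move: uL1'; rewrite terms_cons /= => /and3P[].
have p1L1 : p1 \notin L1 by have := terms_uniq uL1' => /= /andP[].
rewrite -/R0 in prof1 eR1; rewrite eR1 in prof1.
set R1 := (H :\: P1) :\: [set x in terms L1] in prof1 eR1.
have see1 z : z \in R1 -> deg_in z P1 <= 3 by apply: profile_see prof1.
have P15 : #|P1| <= 5 by rewrite cP1.
have cHP1 : #|H :\: P1| = #|H| - #|P1| by rewrite cardsD (setIidPr P1H).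
have le1 := subset_leq_card P1H.
have dR1 : [disjoint R1 & P1].
  by rewrite -setI_eq0; apply/eqP/setP=> x; rewrite in_setI in_set0 /R1 !in_setD; case: (x \in P1); rewrite ?andbF.
have R1H : R1 \subset H by apply: subset_trans (subsetDl _ _) (subsetDl _ _).
have [ex2|no2] := classic (exists p q, p \in L1 /\ walk e R1 p.1 p.2 q); last first.
  right; case: L1 @R1 sL1 tL1 uL1 no2 {eR1 pe1 uL1' p1L1} prof1 see1 dR1 R1H => [//|u1 [//|u2 [//|u3 [|//]]]].
  move=> R1 _ tL1 uL1 no2 prof1 see1 dR1 R1H.
  have no u : u \in [:: u1; u2; u3] -> ~ (exists q, walk e R1 u.1 u.2 q).
    by move=> uL3 [q w]; apply: no2; exists u, q.
  have tH x : x \in terms [:: u1; u2; u3] -> x \in H.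
    by move=> h; have := tL1 _ h; rewrite inE => /andP[].
  have tE : [set x in terms [:: u1; u2; u3]] =
      [set u1.1; u1.2] :|: [set u2.1; u2.2] :|: [set u3.1; u3.2].
    by apply/setP=> x; rewrite /terms /= !inE -!orbA.
  have c3 : #|[set u3.1; u3.2]| = 2.
    by rewrite cards2; have -> := terms_neq uL1 (_ : u3 \in _); rewrite ?inE ?eqxx ?orbT.
  have T1H : [set x in terms [:: u1; u2; u3]] \subset H :\: P1.
    by apply/subsetP=> x; rewrite inE; apply: tL1.
  have u3sub : [set u3.1; u3.2] \subset H :\: P1.
    by apply: subset_trans T1H; rewrite tE subsetUr.
  apply: (@separated R1 P1 [set u3.1; u3.2] c1 set0 o1 1 u1 u2) => //.
  - have cT3 : #|[set x in terms [:: u1; u2; u3]]| = 6.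
      by rewrite cardsE (card_uniqP uL1) size_terms.
    have : #|R1| = #|H| - #|P1| - 6 by rewrite cardsD (setIidPr T1H) cHP1 cT3.
    by have := subset_leq_card T1H; rewrite cHP1 cT3 c3; move: le1; clear; lia.
  - apply/subsetP=> x xH; rewrite in_setU in_setU in_setU in_setU.
    have [xP|xP] := boolP (x \in P1); first by rewrite !orbT.
    rewrite /R1 in_setD [x \in H :\: P1]in_setD xP xH andbT tE !in_setU.
    by do 6!case: (x \in [set _]).
  - by apply: subset_trans u3sub (subsetDl _ _).
  - rewrite -setI_eq0; apply/eqP/setP=> x; rewrite in_setI in_set0; apply/negP=> /andP[].
    by rewrite /R1 in_setD tE in_setU negb_or => /andP[/andP[_ /negPf->]].
  - rewrite -setI_eq0; apply/eqP/setP=> x; rewrite in_setI in_set0; apply/negP=> /andP[xP].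
    by move/(subsetP u3sub); rewrite in_setD xP.
  - split; first exact: sub0set.
      by rewrite /visibility c3 cards0; left.
    move=> z zR; have := see_pair zR (no u3 _); rewrite !inE eqxx !orbT => /(_ isT).
    rewrite /deg_in => h; rewrite (_ : #|[set x in set0 | _]| = 0) //.
    by apply/eqP; rewrite cards_eq0; apply/eqP/setP=> x; rewrite !inE.
  - by apply: tH; apply: term1; rewrite inE eqxx.
  - by apply: tH; apply: term2; rewrite inE eqxx.
  - by rewrite c3; move: P15; clear; lia.
  - by apply: no; rewrite inE eqxx.
  - by apply: no; rewrite !inE eqxx orbT.
have [p2 [q2 [p2L w2 min2]]] := shortest_pair ex2.
have q24 : size q2 <= 4 by apply: (second_walk sL1 uL1 tL1 P1H P15 see1 p2L w2 min2).
have min2' q' : walk e R1 p2.1 p2.2 q' -> size q2 <= size q' by apply: min2.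
have [b1 b2] := term_not_in (H :\: P1) p2L; have np2 := terms_neq uL1 p2L.
set P2 := walkset p2.1 p2.2 q2.
have cP2 : #|P2| = (size q2).+2 by apply: walkset_card w2 min2' b1 b2 np2.
have [o2 [c2 prof2]] := walk_profile es w2 min2' b1 b2 np2.
have [P2H tL2 eR2] := residual uL1 tL1 p2L erefl erefl w2.
rewrite -/P2 in prof2 P2H tL2 eR2.
have pe2 := perm_to_rem p2L; set L2 := rem p2 L1 in tL2 eR2 pe2.
have sL2 : size L2 = 2 by have := perm_size pe2; rewrite sL1 /= => -[].
have uL2' : uniq (terms (p2 :: L2)) by rewrite -(perm_uniq (terms_perm pe2)).
have uL2 : uniq (terms L2) by move: uL2'; rewrite terms_cons /= => /and3P[].
have p2L2 : p2 \notin L2 by have := terms_uniq uL2' => /= /andP[].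
rewrite -/R1 in prof2 eR2; rewrite eR2 in prof2.
set R2 := (H :\: P1 :\: P2) :\: [set x in terms L2] in prof2 eR2.
have R21 : R2 \subset R1 by rewrite -eR2 subsetDl.
have P2H' : P2 \subset H by apply: subset_trans P2H (subsetDl _ _).
have d12 : [disjoint P1 & P2].
  rewrite disjoint_sym disjoints_subset; apply: subset_trans P2H _.
  by apply/subsetP=> x; rewrite in_setD in_setC => /andP[].
have cHP2 : #|H :\: P1 :\: P2| = #|H| - #|P1| - #|P2|.
  by rewrite cardsD (setIidPr P2H) cHP1.
have le2 := subset_leq_card P2H.
have tLH x : x \in terms L2 -> x \in H.
  by move=> h; have := tL2 _ h; rewrite !in_setD => /and3P[].
have [[p3 [q3 [p3L w3]]]|no3] := classic (exists p q, p \in L2 /\ walk e R2 p.1 p.2 q).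
  left; have [P3H tL3 eR3] := residual uL2 tL2 p3L erefl erefl w3.
  set P3 := walkset p3.1 p3.2 q3 in P3H tL3 eR3.
  have pe3 := perm_to_rem p3L; set L3 := rem p3 L2 in tL3 eR3 pe3.
  have sL3 : size L3 = 1 by have := perm_size pe3; rewrite sL2 /= => -[].
  have uL3 : uniq (p3 :: L3) by rewrite -(perm_uniq pe3) terms_uniq.
  have sub A1 A2 (B1 : {set V}) : A1 \subset A2 -> A1 :\: B1 \subset A2 :\: B1 by apply: setSD.
  have vHP : H :\: P1 :\: P2 :\: P3 \subset (v |: H) :\: P1 :\: P2 :\: P3.
    by rewrite !setSD // subsetUr.
  apply: (linkable_perm (L := p1 :: L1)); first by rewrite perm_sym.
  apply: (linkable_cons (P := P1)) => //.
  - by apply: subset_trans P1H (subsetUr _ _).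
  - exact: walkset_start.
  - exact: walkset_end.
  - exact: walk_connect w1.
  apply: (linkable_perm (L := p2 :: L2)); first by rewrite perm_sym.
  apply: (linkable_cons (P := P2)) => //.
  - by apply: subset_trans P2H _; rewrite setSD // subsetUr.
  - exact: walkset_start.
  - exact: walkset_end.
  - exact: walk_connect w2.
  apply: (linkable_perm (L := p3 :: L3)); first by rewrite perm_sym.
  apply: (linkable_cons (P := P3)) => //.
  - by apply: subset_trans P3H _; rewrite !setSD // subsetUr.
  - exact: walkset_start.
  - exact: walkset_end.
  - by move: uL3 => /= /andP[].
  - exact: walk_connect w3.
  case: L3 sL3 tL3 {eR3 pe3 uL3} => [//|p4 [|//]] _ tL3.
  have t1 : p4.1 \in H :\: P1 :\: P2 :\: P3 by apply: tL3; rewrite terms_cons inE eqxx.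
  have t2 : p4.2 \in H :\: P1 :\: P2 :\: P3 by apply: tL3; rewrite terms_cons !inE eqxx orbT.
  have inH x : x \in H :\: P1 :\: P2 :\: P3 -> x \in H by rewrite !in_setD => /and4P[].
  apply: (linkable_cons (P := [set p4.1; p4.2; v])) => //; last exact: linkable_nil.
  - rewrite !subUset !sub1set (subsetP vHP _ t1) (subsetP vHP _ t2) /= !in_setD in_setU1 eqxx /= andbT.
    have P3H' : P3 \subset H by apply: subset_trans P3H _; apply: subset_trans (subsetDl _ _) (subsetDl _ _).
    by apply/and3P; split; apply: contra vnH; [apply: (subsetP P3H')|apply: (subsetP P2H')|apply: (subsetP P1H)].
  - by rewrite !inE eqxx.
  - by rewrite !inE eqxx orbT.
  - apply: (connect_trans (y := v)); apply: connect_edge; rewrite ?inE ?eqxx ?orbT //.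
      by rewrite es vH ?inH.
    by rewrite vH ?inH.
right; case: L2 @R2 sL2 tL2 uL2 tLH no3 {eR2 pe2 uL2' p2L2} prof2 R21 => [//|u1 [//|u2 [|//]]].
move=> R2 _ tL2 uL2 tLH no3 prof2 R21.
have no u : u \in [:: u1; u2] -> ~ (exists q, walk e R2 u.1 u.2 q).
  by move=> uL4 [q w]; apply: no3; exists u, q.
have tE : [set x in terms [:: u1; u2]] = [set u1.1; u1.2] :|: [set u2.1; u2.2].
  by apply/setP=> x; rewrite /terms /= !inE -!orbA.
have T2H : [set x in terms [:: u1; u2]] \subset H :\: P1 :\: P2.
  by apply/subsetP=> x; rewrite inE; apply: tL2.
have dR2 : [disjoint R2 & P2].
  rewrite -setI_eq0; apply/eqP/setP=> x; rewrite in_setI in_set0 /R2 !in_setD.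
  by case: (x \in P2); rewrite ?andbF.
apply: (@separated R2 P1 P2 c1 c2 o1 o2 u1 u2) => //.
- have cT2 : #|[set x in terms [:: u1; u2]]| = 4.
    by rewrite cardsE (card_uniqP uL2) size_terms.
  have : #|R2| = #|H| - #|P1| - #|P2| - 4 by rewrite cardsD (setIidPr T2H) cHP2 cT2.
  by have := subset_leq_card T2H; rewrite cHP2 cT2; move: le1 le2; rewrite cHP1; clear; lia.
- apply/subsetP=> x xH; rewrite in_setU in_setU in_setU in_setU.
  have [xP1|xP1] := boolP (x \in P1); first by rewrite !orbT.
  have [xP2|xP2] := boolP (x \in P2); first by rewrite !orbT.
  rewrite /R2 in_setD [x \in H :\: P1 :\: P2]in_setD [x \in H :\: P1]in_setD xP1 xP2 xH andbT tE !in_setU.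
  by do 4!case: (x \in [set _]).
- exact: subset_trans R21 R1H.
- exact: disjointWl R21 dR1.
- exact: profile_sub R21 prof1.
- by apply: tLH; apply: term1; rewrite inE eqxx.
- by apply: tLH; apply: term2; rewrite inE eqxx.
- by rewrite cP2; move: P15 q24; clear; lia.
- by apply: no; rewrite inE eqxx.
- by apply: no; rewrite !inE eqxx orbT.
Qed.

End Dense.

(** * Massed graphs are linked *)

Section Main.
Variable V : finType.
Implicit Types (e f : rel V) (S W X : {set V}) (l c : V -> nat).

(* Edges between terminals with different labels are useless for a linkage, so
   they can be added for free. *)
Definition join_boundary e X l : rel V :=
  fun a b => e a b || [&& a \in X, b \in X & l a != l b].

(** The labels serve to bound the exceptions: when differently labelled terminals are adjacent, a
    terminal can miss only its partner. Then either some K in N(v) + v is a hub with D empty, or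
    N(v) is a hub with D = {v}. *)
Lemma minimal_step e W X : symmetric e -> irreflexive e -> massed e W X ->
  (forall e' W' X', symmetric e' -> irreflexive e' -> massed e' W' X' ->
     #|W'| < #|W| -> linked e' (W' :|: X') X') ->
  (forall e', symmetric e' -> irreflexive e' -> massed e' W X ->
     arcs e' W < arcs e W -> linked e' (W :|: X) X) ->
  forall l, atmost2 X l -> (forall x y, x \in X -> y \in X -> l x != l y -> e x y) ->
  linked e (W :|: X) X.
Proof.
move=> es ei mass IHW IHE l l2 joined; apply: NNPP => nl.
have aW := arcs_bound es ei mass IHW nl IHE.
have [v vW [v29 v30]] := low_vertex es ei mass IHW nl aW.
have [WX cW X8 mW mass2] := mass.
set H := [set y | e v y] in v29 v30.
(* The exceptional vertices: terminals at v whose partner is also at v but not adjacent to them. *)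
pose E := [set x in H | (x \in X) &&
  [exists y, [&& y \in H, y \in X, y != x, l x == l y & ~~ e x y]]].
have HP y : (y \in H) = e v y by rewrite inE.
have HU : H \subset W :|: X by apply/subsetP=> y; rewrite HP; apply: cW.
have vX : v \notin X by rewrite (disjointFr WX vW).
have HE : #|H| + #|E| <= 30.
  apply: leq_trans v30; rewrite leq_add2l; apply: subset_leq_card; apply/subsetP=> x.
  by rewrite !inE => /and3P[-> ->].
have partner x : x \in E -> exists y, [/\ y \in E, y != x & ~~ e x y].
  rewrite inE => /and3P[xH xX /existsP[y /and5P[yH yX yx lxy xy]]]; exists y; split=> //.
  rewrite inE yH yX; apply/existsP; exists x.
  by rewrite xH xX eq_sym yx eq_sym lxy es xy.
have E1 : #|E| != 1.
  apply/negP=> /cards1P[x Ex]; have [|y [yE yx _]] := partner x; first by rewrite Ex inE.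
  by move: yE; rewrite Ex inE (negPf yx).
have E2 : #|E| = 2 -> forall x y, x \in E -> y \in E -> x != y -> ~~ e x y.
  move=> c2 x y xE yE xy; have [z [zE zx xz]] := partner x xE.
  suff -> : y = z by [].
  move: c2; rewrite (cardsD1 x) xE => -[c1].
  have /card_le1_eqP h : #|E :\ x| <= 1 by move: c1; clear; lia.
  by apply: h; rewrite !in_setD1 ?zx ?zE ?yE // eq_sym xy.
have degH h : h \in H -> 15 <= deg_in e h H + (h \in E).
  move=> hH; have vh : e v h by rewrite -HP.
  have hv : e h v by rewrite es.
  (* The 16 vertices include h itself; each of the 15 others is a neighbour of h or its missing
     partner. *)
  have := contract_bound es ei mass IHW nl vW (subsetP HU _ hH) hv.
  set B := [set w | _].
  pose N := [set w in H | [&& w \in X, h \in X, w != h & ~~ e h w]].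
  have BN : B \subset h |: ([set y in H | e h y] :|: N).
    apply/subsetP=> w; rewrite in_setU1 in_setU [w \in B]inE -HP => /andP[wH].
    have [//|wh] := eqVneq w h; rewrite /= => hw.
    have [ehw|ehw] := boolP (e h w); first by rewrite inE wH ehw.
    move: hw; rewrite (negPf ehw) /= => /andP[wX hX].
    by apply/orP; right; rewrite inE wH wX hX wh ehw.
  have N1 : #|N| <= (h \in E).
    have [hE|hE] := boolP (h \in E); last first.
      rewrite leqn0 cards_eq0; apply/eqP/setP=> w; rewrite in_set0; apply/negP.
      rewrite inE => /and5P[wH wX hX wh hw]; case/negP: hE; rewrite inE hH hX; apply/existsP; exists w.
      rewrite wH wX wh hw andbT; apply: contraT => lw; move: hw; rewrite joined //.
    apply/card_le1_eqP=> w w'; rewrite !inE => /and5P[wH wX hX wh hw] /and5P[wH' wX' _ wh' hw'].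
    have lw : l w = l h by apply/eqP; apply: contraT => lw; rewrite es joined in hw.
    have lw' : l w' = l h by apply/eqP; apply: contraT => lw'; rewrite es joined in hw'.
    apply/eqP; apply: contraT => ww'; have := l2 (l h); rewrite leqNgt => /negP; case.
    apply: (@leq_trans #|h |: [set w; w']|).
      by rewrite cardsU1 cards2 !inE negb_or ![h == _]eq_sym wh wh' [w == w']eq_sym ww'.
    by apply: subset_leq_card; apply/subsetP=> z; rewrite !inE => /or3P[]/eqP->; rewrite ?hX ?wX ?wX' ?lw ?lw' eqxx.
  have := leq_trans (subset_leq_card BN) (leq_card_setU _ _); rewrite cards1.
  have : #|[set y in H | e h y] :|: N| <= deg_in e h H + #|N| by apply: (leq_card_setU _ _).
  by move: N1; clear; lia.
have H8 : 8 <= #|H|.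
  have [h vh] := no_isolated es ei mass IHW nl vW.
  have hH : h \in H by rewrite HP.
  by move: (degH h hH) (deg_in_le e h H) (leq_b1 (h \in E)); clear; lia.
have vH h : h \in H -> e v h by rewrite HP.
have rl W2 S2 : W2 != set0 -> W2 \subset W -> S2 \subset (W :|: X) :\: W2 -> #|S2| < #|X| ->
    closed_in e W2 S2 -> linked e (W2 :|: S2) S2 -> False.
  by move=> h1 h2 h3 h4 h5 h6; apply: nl; apply: (rigid_lt es ei mass IHW (W1 := W2) (S := S2)).
have vnH : v \notin H by rewrite HP ei.
have [hk|nk] := classic (has_hub e v H).
  case: hk => K [KH K8 hK].
  have KU : K \subset (W :|: X) :\: set0.
    rewrite setD0; apply: subset_trans KH _; rewrite subUset sub1set HU andbT.
    by rewrite in_setU vW.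
  have c0 : closed_in e set0 K by move=> w y; rewrite in_set0.
  have XK : #|X| <= #|K| by apply: leq_trans X8 K8.
  case: (hub_linked es WX cW X8 (sub0set _) KU c0 XK hK) => // -[W2 [S2 [h1 h2 h3 h4 [h5 h6]]]].
  exact: (rl W2 S2).
have hv : hub e [set v] H.
  apply: hub_of_linkable => // L sL uL tL.
  by case: (dense_neighbourhood es ei vH v29 HE E1 E2 degH sL uL tL).
have vW' : [set v] \subset W by rewrite sub1set.
have HU' : H \subset (W :|: X) :\: [set v].
  apply/subsetP=> y yH; rewrite in_setD (subsetP HU _ yH) andbT inE.
  by apply: contraTneq yH => ->.
have cv : closed_in e [set v] H.
  by move=> w y; rewrite inE => /eqP-> vy; rewrite in_setU HP vy orbT.
have XH : #|X| <= #|H| by apply: leq_trans X8 H8.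
case: (hub_linked es WX cW X8 vW' HU' cv XH hv) => // -[W2 [S2 [h1 h2 h3 h4 [h5 h6]]]].
exact: (rl W2 S2).
Qed.

(** Induction on |W|, then on the number of arcs. Edges inside X change neither, so the graph can be
    augmented for each labelling separately. *)
Theorem massed_linked e W X : symmetric e -> irreflexive e -> massed e W X ->
  linked e (W :|: X) X.
Proof.
move En : #|W| => n; elim/ltn_ind: n e W X En => n IHn e W X En.
move Em : (arcs e W) => m; elim/ltn_ind: m e Em => m IHm e Em es ei mass l l2.
pose f := join_boundary e X l.
have fs : symmetric f by move=> a b; rewrite /f /join_boundary es andbCA [l a == _]eq_sym.
have fi : irreflexive f by move=> a; rewrite /f /join_boundary ei eqxx !andbF.
have [WX cW X8 mW mass2] := mass.
have WnX w : w \in W -> w \notin X by move=> wW; rewrite (disjointFr WX wW).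
have fE a b : (a \in W) || (b \in W) -> f a b = e a b.
  by case/orP=> /WnX/negPf h; rewrite /f /join_boundary h ?andbF orbF.
have arcsE W' : W' \subset W -> arcs f W' = arcs e W'.
  move=> /subsetP sW; apply: eq_card => p; rewrite !inE.
  have [h|_] := boolP ((p.1 \in W') || (p.2 \in W')); last by rewrite !andbF.
  by rewrite fE //; case/orP: h => /sW->; rewrite ?orbT.
have bdE W' : W' \subset W -> boundary f W' = boundary e W'.
  move=> /subsetP sW; apply/setP=> y; rewrite !inE; congr (_ && _).
  apply: eq_existsb => w; have [wW|//] := boolP (w \in W'); by rewrite fE // sW.
have massf : massed f W X.
  split=> //; first by move=> w y wW; rewrite fE ?wW //; apply: cW.
    by rewrite arcsE.
  by move=> W' sW; rewrite bdE // arcsE //; apply: mass2.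
have : linked f (W :|: X) X.
  apply: (minimal_step fs fi massf _ _ l2).
  - by move=> e' W' X' e's e'i m' lt; apply: (IHn #|W'|) => //; rewrite -En.
  - move=> e' e's e'i m'; rewrite arcsE // Em => lt.
    exact: (IHm _ lt e').
  - by move=> x y xX yX lxy; rewrite /f /join_boundary xX yX lxy orbT.
move=> /(_ l l2)[c cl cc]; exists c => // x y xX yX lxy.
apply: connect_subrel (cc x y xX yX lxy) => a b /and4P[ab cab aU bU].
rewrite /color_rel cab aU bU !andbT; case/orP: ab => // /and3P[aX bX].
by rewrite -!cl // cab.
Qed.

End Main.

(** * From 30-connected graphs to massed graphs *)

Section Graphs.
Variable G : sgraph.
Implicit Types S : {set G}.

Lemma connected_restr S : connected_graph (del_vertices S) ->
  forall x y, x \notin S -> y \notin S -> connect (restr (@adj G) (~: S)) x y.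
Proof.
move=> cG x y xS yS.
have := cG (exist _ x xS) (exist _ y yS); case/connectP=> p.
elim: p x xS {cG} => [|z p IH] x xS /=; first by move=> _ [->]; apply: connect0.
case/andP=> xz zp ey; case: z xz zp ey => z zS xz zp ey.
apply: (connect_trans (y := z)); last exact: (IH z zS).
by apply: connect1; rewrite /restr !inE xS zS !andbT.
Qed.

Lemma min_degree_connected m : m_connected m G -> forall x : G, m <= #|[set y | adj x y]|.
Proof.
move=> [mG conn] x; rewrite leqNgt; apply/negP=> lt; set S := [set y | adj x y] in lt.
have xS : x \notin S by rewrite inE adj_irrefl.
have : 0 < #|~: (x |: S)|.
  by have := cardsC (x |: S); rewrite cardsU1 xS; move: mG lt; clear; lia.
rewrite card_gt0 => /set0Pn[y]; rewrite in_setC in_setU1 negb_or => /andP[yx yS].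
have h := connected_restr (conn S lt) xS yS.
case/negP: yx; apply: (connect_keep (P := pred1 x) _ _ h); first exact: eqxx.
by move=> a b /eqP-> /and3P[xb _]; rewrite !inE xb.
Qed.

(** Every vertex off X starts at least 30 arcs, and one arc from X to a vertex off X makes the
    inequality strict. A part of the interior behind fewer than 8 vertices is empty, because its
    boundary would separate it from X. *)
Lemma massed_connected (X : {set G}) : m_connected 30 G -> #|X| = 8 -> massed (@adj G) (~: X) X.
Proof.
move=> mG cX; have deg := min_degree_connected mG; have [G30 conn] := mG.
split; last first.
- move=> W' sW b8; have [->|/set0Pn[w wW']] := eqVneq W' set0; first by rewrite arcs0.
  have lt : #|boundary (@adj G) W'| < 30 by apply: leq_trans b8 _; rewrite cX.
  have [x xX xb] : exists2 x, x \in X & x \notin boundary (@adj G) W'.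
    by apply/subsetPn; apply: contraTN b8 => /subset_leq_card; rewrite leqNgt.
  have wb : w \notin boundary (@adj G) W' by rewrite inE wW'.
  have h := connected_restr (conn _ lt) wb xb.
  have : x \in W'.
    apply: (connect_keep (P := fun z => z \in W') wW' _ h) => a b aW /and3P[ab _]; rewrite in_setC.
    by apply: contraR => bW; apply: in_boundary ab bW.
  by move/(subsetP sW); rewrite in_setC xX.
- have [x xX] : exists x, x \in X by apply/set0Pn; rewrite -card_gt0 cX.
  have [y yX xy] : exists2 y, y \notin X & adj x y.
    have : ~~ ([set y | adj x y] \subset X).
      by apply: contraTN (deg x) => /subset_leq_card; rewrite cX; clear; lia.
    by case/subsetPn=> y; rewrite inE => h1 h2; exists y.
  apply: (@leq_ltn_trans #|[set p : G * G | adj p.1 p.2 && (p.1 \in ~: X)]|).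
    rewrite -(sum1dep_card (fun p : G * G => adj p.1 p.2 && (p.1 \in ~: X))).
    rewrite (eq_bigl (fun p : G * G => (p.1 \in ~: X) && adj p.1 p.2)); last by move=> p; rewrite andbC.
    rewrite -(pair_big_dep (fun a => a \in ~: X) (fun a b => adj a b) (fun _ _ => 1)) /=.
    rewrite mulnC -sum_nat_const; apply: leq_sum => a _; rewrite sum1dep_card; exact: deg.
  apply: proper_card; apply/properP; split.
    by apply/subsetP=> p; rewrite !inE => /andP[-> ->].
  by exists (x, y); rewrite !inE /= ?xy ?yX ?orbT // xX andbF.
- by rewrite cX.
- by move=> w y _ _; rewrite setUC setUCr.
- by rewrite -setI_eq0 setIC setICr.
Qed.

Lemma linked4_of_connected : m_connected 30 G -> k_linked 4 G.
Proof.
move=> mG; have [G30 _] := mG; split; first by apply: leq_trans (ltnW G30).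
move=> u v uv; pose X : {set G} := [set x in u ++ v].
have cX : #|X| = 8 by rewrite cardsE (card_uniqP uv) size_cat !size_tuple.
have lk := massed_linked (@adj_sym G) (@adj_irrefl G) (massed_connected mG cX).
have [uu [uvn vv]] : uniq u /\ (forall x, x \in v -> x \notin u) /\ uniq v.
  move: uv; rewrite cat_uniq => /and3P[h1 /hasPn h2 h3]; split=> //; split=> // x; exact: h2.
(* The label of a terminal is the number of its pair, so the i-th path has colour i throughout, and
   distinct paths are disjoint. *)
pose l x := if x \in u then index x u else index x v.
have lu i : l (tnth u i) = i.
  by rewrite /l mem_tnth (tnth_nth (tnth u i)) index_uniq // size_tuple.
have lv i : l (tnth v i) = i.
  rewrite /l (negPf (uvn _ (mem_tnth _ _))) (tnth_nth (tnth v i)) index_uniq //.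
  by rewrite size_tuple.
have XP x : x \in X -> exists i, (x == tnth u i) || (x == tnth v i).
  by rewrite inE mem_cat => /orP[]/tnthP[i ->]; exists i; rewrite eqxx ?orbT.
have l2 : atmost2 X l.
  move=> i; have [i4|i4] := ltnP i 4.
    apply: (@leq_trans #|[set tnth u (Ordinal i4); tnth v (Ordinal i4)]|).
      apply: subset_leq_card; apply/subsetP=> x; rewrite inE => /andP[/XP[j h] /eqP lx].
      have ej : j = Ordinal i4.
        by apply: val_inj => /=; rewrite -lx; case/orP: h => /eqP->; rewrite ?lu ?lv.
      by rewrite -ej !inE.
    by rewrite cards2; case: (_ != _).
  rewrite (_ : [set x in X | l x == i] = set0) ?cards0 //.
  apply/setP=> x; rewrite in_set0 inE; apply/negP=> /andP[/XP[j h] /eqP lx].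
  by move: i4; rewrite -lx leqNgt; case/orP: h => /eqP->; rewrite ?lu ?lv ltn_ord.
have [c cl cc] := lk l l2.
have uX i : tnth u i \in X by rewrite inE mem_cat mem_tnth.
have vX i : tnth v i \in X by rewrite inE mem_cat mem_tnth orbT.
have [p hp] : exists p : 'I_4 -> seq G, forall i, is_path (tnth u i) (tnth v i) (p i) /\
    forall z, z \in tnth u i :: p i -> c z = i.
  apply: (fin_all_exists (P := fun i (q : seq G) => is_path (tnth u i) (tnth v i) q /\
    forall z, z \in tnth u i :: q -> c z = i)) => i.
  have := cc _ _ (uX i) (vX i); rewrite lu lv => /(_ erefl)/connectP[q pq eq].
  case: (shortenP pq) eq => q' pq' uq' _ eq; exists q'; split.
    split=> //; apply: sub_path pq' => a b; by case/and4P.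
  have cu : c (tnth u i) = i by rewrite cl ?lu.
  have : forall x, c x = i -> path (color_rel (@adj G) c (~: X :|: X)) x q' ->
      forall z, z \in x :: q' -> c z = i.
    elim: (q') => [|y s IH] x cx /=; first by move=> _ z; rewrite inE => /eqP->.
    case/andP=> /and4P[_ /eqP cxy _ _] ps z; rewrite inE => /orP[/eqP->//|].
    by apply: IH => //; rewrite -cxy.
  by move/(_ _ cu pq').
exists p; split=> [i|i j ij]; first by case: (hp i).
apply/pred0P=> z /=; apply/negP=> /andP[zi zj].
have [_ hi] := hp i; have [_ hj] := hp j.
by case/eqP: ij; apply: val_inj; rewrite /= -(hi z zi) -(hj z zj).
Qed.

End Graphs.

Theorem theorem1p4 :
  (forall G : sgraph, m_connected 30 G -> k_linked 4 G) /\
  (exists2 g4 : nat, is_g 4 g4 & g4 <= 30).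
Proof.
have h : forall G : sgraph, m_connected 30 G -> k_linked 4 G.
  by move=> G; apply: linked4_of_connected.
split=> //.
have [n [hn minn]] := @exists_minimum nat (connectivity_forces_linked 4) id (ex_intro _ 30 h).
by exists n; [split|apply: minn].
Qed.
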